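(* Let $M$ be a linear Hopf manifold of dimension $n$ and let $\alpha>0$, $\beta>-\alpha$ be real numbers. The Bismut curvature tensor $\Omega^B$ associated to the metric $g(\alpha,\beta)$ on $M$ satisfies (Cplx), i.e. $\Omega^B\in\wedge^{1,1}M\otimes\wedge^{1,1}M$.
   Context: A linear Hopf manifold of complex dimension $n$ is $M^n=(\mathbb C^n\setminus\{0\})/\!\sim$, where $(z_1,\dots,z_n)\sim(a_1z_1,\dots,a_nz_n)$ for a fixed $a\in\mathbb C^n\setminus\{0\}$ with $|a_1|=\dots=|a_n|\ne1$, with its natural complex structure. For real $\alpha>0$, $\beta>-\alpha$, $g(\alpha,\beta)$ is the Hermitian metric $g(\alpha,\beta)_{i\bar j}=\alpha\frac{\delta_{ij}}{|z|^2}+\beta\frac{\bar z_iz_j}{|z|^4}$. The Bismut connection $\nabla^+$ of a Hermitian manifold $(M,g,J)$ is the unique Hermitian connection ($\nabla^+g=0$, $\nabla^+J=0$) with totally skew-symmetric torsion; $\Omega^B$ is its curvature tensor with all indices lowered by $g$, $\Omega^B(X,Y,Z,W)=g(R^+(X,Y)Z,W)$ with $R^+(X,Y)=[\nabla^+_X,\nabla^+_Y]-\nabla^+_{[X,Y]}$, extended complex-multilinearly. (Cplx) is equivalent to $\Omega^B_{ijk\bar l}=0$ for all $i,j,k,l$. *)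

(* Defs.v *)
From HB Require Import structures.
From mathcomp Require Import all_boot all_order all_algebra.
From mathcomp Require Import all_classical all_reals all_analysis.
From mathcomp Require Import complex.

Set Implicit Arguments.
Unset Strict Implicit.
Unset Printing Implicit Defensive.

Import Order.TTheory GRing.Theory Num.Theory.
Import numFieldNormedType.Exports.

Local Open Scope classical_set_scope.
Local Open Scope ring_scope.

(* The real normed space underlying C^n: (x, y) stands for z = x + i y.       *)
(* Points of C^n and real tangent vectors at those points both live here, so  *)
(* that the derivatives below are derivatives along real directions.          *)
Notation Cn R n := ('rV[R]_n * 'rV[R]_n)%type.

Section Hopf.
Variables (R : realType) (n : nat).
Local Notation V := (Cn R n).
Implicit Types (z v w : V) (a : 'rV[R[i]]_n).

Definition toC v : 'rV[R[i]]_n := \row_j (v.1 0 j +i* v.2 0 j)%C.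
Definition ofC (c : 'rV[R[i]]_n) : V :=
  (\row_j complex.Re (c 0 j), \row_j complex.Im (c 0 j)).

(* Multiplication by i: the natural complex structure. *)
Definition Jst v : V := (- v.2, v.1).

Definition punctured : set V := [set z | z != 0].

(* The generator z |-> (a_1 z_1, ..., a_n z_n) of the equivalence relation    *)
(* defining the Hopf manifold M. Being linear, it is also its own             *)
(* differential at every point.                                               *)
Definition hopf a z : V := ofC (\row_j (a 0 j * toC z 0 j)).

(* C^infinity on U: every iterated directional derivative is Frechet          *)
(* differentiable at every point of U.                                        *)
Definition smooth_on (W : normedModType R) (U : set V) (f : V -> W) : Prop :=
  forall (vs : seq V) z, U z ->
    differentiable (foldr (fun v (h : V -> W) => fun x => 'D_v h x) f vs) z.

(* The quotient map C^n \ {0} -> M is a holomorphic covering, with group      *)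
(* generated by hopf a. Smooth functions and smooth vector fields on M are    *)
(* encoded by their pullbacks, i.e. by the invariant smooth functions and     *)
(* vector fields on C^n \ {0}. Values at 0 are junk: every identity below is  *)
(* only required on [punctured].                                              *)
Definition is_function a (f : V -> R) : Prop :=
  smooth_on punctured f /\
  forall z, punctured z -> f (hopf a z) = f z.

Definition is_vfield a (X : V -> V) : Prop :=
  smooth_on punctured X /\
  forall z, punctured z -> X (hopf a z) = hopf a (X z).

Definition bracket (X Y : V -> V) : V -> V :=
  fun z => 'D_(X z) Y z - 'D_(Y z) X z.

(* An affine connection on M; [nabla X Y] is nabla_X Y. *)
Record is_connection a (nabla : (V -> V) -> (V -> V) -> (V -> V)) : Prop :=
  IsConnection {
    conn_vfield : forall X Y, is_vfield a X -> is_vfield a Y ->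
      is_vfield a (nabla X Y);
    (* nabla does not see the junk values at 0 *)
    conn_ext : forall X X' Y Y',
      is_vfield a X -> is_vfield a X' -> is_vfield a Y -> is_vfield a Y' ->
      (forall z, punctured z -> X z = X' z) ->
      (forall z, punctured z -> Y z = Y' z) ->
      forall z, punctured z -> nabla X Y z = nabla X' Y' z;
    conn_linear : forall f X X' Y,
      is_function a f -> is_vfield a X -> is_vfield a X' -> is_vfield a Y ->
      forall z, punctured z ->
      nabla (fun x => f x *: X x + X' x) Y z
      = f z *: nabla X Y z + nabla X' Y z;
    conn_additive : forall X Y Y',
      is_vfield a X -> is_vfield a Y -> is_vfield a Y' ->
      forall z, punctured z ->
      nabla X (fun x => Y x + Y' x) z = nabla X Y z + nabla X Y' z;
    conn_leibniz : forall f X Y,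
      is_function a f -> is_vfield a X -> is_vfield a Y ->
      forall z, punctured z ->
      nabla X (fun x => f x *: Y x) z
      = 'D_(X z) f z *: Y z + f z *: nabla X Y z
  }.

(* A (pseudo-)Riemannian metric is given as a field of real bilinear forms:   *)
(* [g z v w] is g_z(v, w).                                                    *)
Definition metric_parallel a (g : V -> V -> V -> R)
    (nabla : (V -> V) -> (V -> V) -> (V -> V)) : Prop :=
  forall X Y Z, is_vfield a X -> is_vfield a Y -> is_vfield a Z ->
  forall z, punctured z ->
    'D_(X z) (fun x => g x (Y x) (Z x)) z
    = g z (nabla X Y z) (Z z) + g z (Y z) (nabla X Z z).

Definition J_parallel a (nabla : (V -> V) -> (V -> V) -> (V -> V)) : Prop :=
  forall X Y, is_vfield a X -> is_vfield a Y ->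
  forall z, punctured z ->
    nabla X (fun x => Jst (Y x)) z = Jst (nabla X Y z).

Definition torsion (nabla : (V -> V) -> (V -> V) -> (V -> V))
    (X Y : V -> V) : V -> V :=
  fun z => nabla X Y z - nabla Y X z - bracket X Y z.

Definition skew_torsion a (g : V -> V -> V -> R)
    (nabla : (V -> V) -> (V -> V) -> (V -> V)) : Prop :=
  forall X Y Z, is_vfield a X -> is_vfield a Y -> is_vfield a Z ->
  forall z, punctured z ->
    g z (torsion nabla X Y z) (Z z) = - g z (torsion nabla Y X z) (Z z) /\
    g z (torsion nabla X Y z) (Z z) = - g z (torsion nabla X Z z) (Y z).

Definition is_bismut a (g : V -> V -> V -> R)
    (nabla : (V -> V) -> (V -> V) -> (V -> V)) : Prop :=
  [/\ is_connection a nabla, metric_parallel a g nabla, J_parallel a nabla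
    & skew_torsion a g nabla].

Definition curvature (nabla : (V -> V) -> (V -> V) -> (V -> V))
    (X Y Z : V -> V) : V -> V :=
  fun z => nabla X (nabla Y Z) z - nabla Y (nabla X Z) z
           - nabla (bracket X Y) Z z.

Definition Omega (g : V -> V -> V -> R)
    (nabla : (V -> V) -> (V -> V) -> (V -> V))
    (X Y Z W : V -> V) : V -> R :=
  fun z => g z (curvature nabla X Y Z z) (W z).

(* A covariant 4-tensor field on M: a C^infinity(M)-multilinear map from      *)
(* quadruples of vector fields to functions.                                  *)
Definition is_tensor4 a
    (T : (V -> V) -> (V -> V) -> (V -> V) -> (V -> V) -> V -> R) : Prop :=
  (forall X Y Z W, is_vfield a X -> is_vfield a Y -> is_vfield a Z ->
     is_vfield a W -> is_function a (T X Y Z W)) /\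
  (forall f X' X Y Z W, is_function a f -> is_vfield a X' -> is_vfield a X ->
     is_vfield a Y -> is_vfield a Z -> is_vfield a W ->
   forall z, punctured z ->
     [/\ T (fun x => f x *: X x + X' x) Y Z W z
           = f z * T X Y Z W z + T X' Y Z W z,
         T X (fun x => f x *: Y x + X' x) Z W z
           = f z * T X Y Z W z + T X X' Z W z,
         T X Y (fun x => f x *: Z x + X' x) W z
           = f z * T X Y Z W z + T X Y X' W z
       & T X Y Z (fun x => f x *: W x + X' x) z
           = f z * T X Y Z W z + T X Y Z X' z]).

(* A complex vector field X.1 + i X.2 (a section of TM (x) C) is encoded by   *)
(* the pair of its real and imaginary parts.                                  *)
Definition is_cvfield a (X : (V -> V) * (V -> V)) : Prop :=
  is_vfield a X.1 /\ is_vfield a X.2.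

Definition part (X : (V -> V) * (V -> V)) (p : bool) : V -> V :=
  if p then X.2 else X.1.

(* Type (1,0): J X = i X, where i (X.1 + i X.2) = - X.2 + i X.1. *)
Definition type10 (X : (V -> V) * (V -> V)) : Prop :=
  forall z, punctured z -> Jst (X.1 z) = - X.2 z /\ Jst (X.2 z) = X.1 z.

(* Type (0,1): J X = - i X. *)
Definition type01 (X : (V -> V) * (V -> V)) : Prop :=
  forall z, punctured z -> Jst (X.1 z) = X.2 z /\ Jst (X.2 z) = - X.1 z.

Definition cext (T : (V -> V) -> (V -> V) -> (V -> V) -> (V -> V) -> V -> R)
    (X Y Z W : (V -> V) * (V -> V)) (z : V) : R[i] :=
  \sum_(p : bool) \sum_(q : bool) \sum_(r : bool) \sum_(s : bool)
    ('i%C : R[i]) ^+ (p + q + r + s)%N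
      * (T (part X p) (part Y q) (part Z r) (part W s) z)%:C%C.

(* T is a section of /\^{1,1} M (x) /\^{1,1} M. *)
Definition in_L11_L11 a
    (T : (V -> V) -> (V -> V) -> (V -> V) -> (V -> V) -> V -> R) : Prop :=
  [/\ is_tensor4 a T,
      (forall X Y Z W, is_vfield a X -> is_vfield a Y -> is_vfield a Z ->
         is_vfield a W -> forall z, punctured z ->
         T Y X Z W z = - T X Y Z W z /\ T X Y W Z z = - T X Y Z W z),
      (forall X Y Z W, is_cvfield a X -> is_cvfield a Y -> is_cvfield a Z ->
         is_cvfield a W ->
         (type10 X /\ type10 Y) \/ (type01 X /\ type01 Y) ->
         forall z, punctured z -> cext T X Y Z W z = 0)
    & (forall X Y Z W, is_cvfield a X -> is_cvfield a Y -> is_cvfield a Z ->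
         is_cvfield a W ->
         (type10 Z /\ type10 W) \/ (type01 Z /\ type01 W) ->
         forall z, punctured z -> cext T X Y Z W z = 0)].

Definition sqnorm z : R[i] := \sum_j `|toC z 0 j| ^+ 2.

(* g(alpha,beta)_{i \bar j} at z *)
Definition hopf_coef (alpha beta : R) z (i j : 'I_n) : R[i] :=
  alpha%:C%C * (i == j)%:R / sqnorm z
  + beta%:C%C * conjc (toC z 0 i) * toC z 0 j / sqnorm z ^+ 2.

(* The real metric whose complex bilinear extension has the components        *)
(* g(d/dz_i, d/d\bar z_j) = g(alpha,beta)_{i \bar j} (and is zero on pairs of *)
(* equal type); the factor 2 comes from v = v^i d/dz_i + conjugate.           *)
Definition hopf_metric (alpha beta : R) z v w : R :=
  2 * complex.Re (\sum_i \sum_j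
    hopf_coef alpha beta z i j * toC v 0 i * conjc (toC w 0 j)).

End Hopf.

(* Main.v *)
Require Import Defs.
From HB Require Import structures.
From mathcomp Require Import all_boot all_order all_algebra.
From mathcomp Require Import all_classical all_reals all_analysis.
From mathcomp Require Import complex ring lra.

Import Order.TTheory GRing.Theory Num.Theory.
Import numFieldNormedType.Exports.
Local Open Scope ring_scope.

(** Write J for multiplication by i, q for the flat real inner product of C^n,
    and D for the flat derivative. A connection on the Hopf manifold is studied
    through its action on the vector fields on C^n minus the origin that are
    invariant under the deck group; the flat inner product rescaled by
    1 / |z|^2 ([br]) is invariant as well, because the deck transformation is a
    similarity, and g(alpha, beta) is polynomial in it.

    The theorem comes from the flatness of the Bismut connection in the (1,0)
    directions. For vector fields X, Y put [nabla10 X Y] = nabla_X Y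
    - J nabla_(JX) Y, twice the derivative of Y along the (1,0) part of X, and
    let [D10] be the same expression in the flat derivative. Skewness of the
    torsion means that, for all X, Y and Z,
      g(nabla_X Y, Z) + g(nabla_Z Y, X) = (L_Y g)(X, Z)
    ([symmetric_part]). Subtracting from this the same identity for JX and JY
    removes the terms in nabla_Z, because nabla J = 0 and g is J-invariant.
    What remains expresses g(nabla10 X Y, Z) by the first derivatives of g
    ([metric_nabla10]), and for the metric g(alpha, beta) it reads
    ([nabla10E], where k = beta / alpha and lam(v) = (v, z) / |z|^2)
      nabla10 X Y = D10 X Y + Gam(X, Y),
      Gam(x, y) = 2 (- lam(y) x + k lam(x) y - k lam(x) lam(y) z).
    The (1,0) derivative of lam(w) along x is -2 lam(x) lam(w), so the
    curvature of D10 + Gam is a polynomial expression in lam, and it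
    vanishes identically ([Gam_flat], [curvature10_eq0]).

    Pairing this flatness with W gives
      (Omega(X, Y, Z, W) - Omega(JX, JY, Z, W))
      + (Omega(JX, Y, Z, JW) + Omega(X, JY, Z, JW)) = 0.
    The first bracket is skew in Z and W, since nabla is metric. The second one
    is symmetric in Z and W, since Omega is moreover J-invariant in its last
    two arguments. So both vanish ([Omega_J_pair]), which is the statement that
    Omega is of type (1,1) in its first two arguments; in the last two this is
    the J-invariance itself.

    That Omega is a tensor, and that it is skew in Z and W, rests on the fact
    that the bracket of vector fields acts as the commutator of derivations
    ([D_bracket_real]), hence on the symmetry of second derivatives
    ([schwarz_real]). *)

Set Implicit Arguments.
Unset Strict Implicit.
Unset Printing Implicit Defensive.
Local Open Scope classical_set_scope.

(** * Differentiability of near-equal functions and of products *)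

Section NearEq.
Variables (R : realType) (V W : normedModType R).

Lemma near_eq_differentiable (f g : V -> W) (x : V) :
  (\near x, f x = g x) -> differentiable f x -> differentiable g x.
Proof.
move=> fg df.
have fgx : f x = g x by exact: nbhs_singleton fg.
have H : g \o shift x = cst (g x) + 'd f x +o_ 0 id.
  apply/eqaddoP => eps eps0.
  have /eqaddoP/(_ eps eps0) := diff_locally df.
  apply: filter_app.
  have : \forall h \near (0 : V), f (h + x) = g (h + x).
    have /(_ _ fg) : (h + x) @[h --> (0 : V)] --> x.
      rewrite -[X in _ --> X](add0r x).
      by apply: cvgD; [exact: cvg_id | exact: cvg_cst].
    by [].
  apply: filterS => h fgh; rewrite !fctE/= fgh fgx.
  by [].
have dg := diff_unique (diff_continuous df) H.
by apply/diff_locallyP; rewrite dg; split => //; exact: diff_continuous.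
Qed.

End NearEq.

Section Product.
Variables (R : realType) (V W : normedModType R).

Let scale (r : R) (w : W) : W := r *: w.

Let scale_is_bilinear :
  bilinear_for
    (GRing.Scale.Law.clone _ _ *:%R _) (GRing.Scale.Law.clone _ _ *:%R _)
    (scale : R -> W -> W).
Proof.
split=> [u'|u] a x y /=.
- by rewrite /scale scalerDl scalerA.
- by rewrite /scale scalerDr !scalerA mulrC.
Qed.

HB.instance Definition _ :=
  bilinear_isBilinear.Build R R W W _ _ scale scale_is_bilinear.

Lemma is_diff_scale (f : V -> R) (g : V -> W) (x : V) :
  differentiable f x -> differentiable g x ->
  is_diff x (fun z => f z *: g z)
    (fun v => f x *: 'd g x v + 'd f x v *: g x).
Proof.
move=> df dg.
have sc : continuous (fun p : R * W => scale p.1 p.2).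
  by move=> p; exact: scale_continuous.
have D : is_diff (f x, g x) (fun p : R * W => scale p.1 p.2)
    (fun q => scale (f x) q.2 + scale q.1 (g x)).
  by apply: DiffDef; [exact: differentiable_bilin | rewrite diff_bilin].
have dp : is_diff x (fun z => (f z, g z)) (fun v => ('d f x v, 'd g x v)).
  by apply: DiffDef; [exact: differentiable_pair | rewrite diff_pair].
exact: (is_diff_comp dp D).
Qed.

End Product.

(** * Directional derivatives and regularity of class C^k *)

Section DirectionalDerivative.
Variables (R : realType) (V W : normedModType R).
Implicit Types (f g : V -> W) (x v : V).

Lemma D_near f g x v : (\near x, f x = g x) -> 'D_v f x = 'D_v g x.
Proof. exact: near_eq_derive. Qed.

Lemma D_open (U : set V) f g x v : open U -> (forall z, U z -> f z = g z) ->
  U x -> 'D_v f x = 'D_v g x.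
Proof.
move=> oU fg Ux; apply: D_near.
by apply: filterS (open_nbhs_nbhs (conj oU Ux)) => z /fg.
Qed.

Lemma D_add f g x v : differentiable f x -> differentiable g x ->
  'D_v (fun z => f z + g z) x = 'D_v f x + 'D_v g x.
Proof. by move=> df dg; apply: deriveD; exact: diff_derivable. Qed.

Lemma D_opp f x v : differentiable f x -> 'D_v (fun z => - f z) x = - 'D_v f x.
Proof. by move=> df; apply: deriveN; exact: diff_derivable. Qed.

Lemma D_sub f g x v : differentiable f x -> differentiable g x ->
  'D_v (fun z => f z - g z) x = 'D_v f x - 'D_v g x.
Proof. by move=> df dg; apply: deriveB; exact: diff_derivable. Qed.

Lemma D_scale (f : V -> R) g x v : differentiable f x -> differentiable g x ->
  'D_v (fun z => f z *: g z) x = f x *: 'D_v g x + 'D_v f x *: g x.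
Proof.
move=> df dg; have H := is_diff_scale df dg.
by rewrite !deriveE// diff_val.
Qed.

Lemma D_inv (f : V -> R) x v : differentiable f x -> f x != 0 ->
  'D_v (fun z => (f z)^-1) x = - ((f x)^-1 * (f x)^-1 * 'D_v f x).
Proof.
move=> df f0; rewrite deriveV//; last exact: diff_derivable.
by rewrite /GRing.scale /= mulNr -exprVn expr2.
Qed.

Lemma D_linear (a : R) (u v : V) f x : differentiable f x ->
  'D_(a *: u + v) f x = a *: 'D_u f x + 'D_v f x.
Proof. by move=> df; rewrite !deriveE// linearP. Qed.

Lemma D_dirD (u v : V) f x : differentiable f x ->
  'D_(u + v) f x = 'D_u f x + 'D_v f x.
Proof. by move=> df; rewrite !deriveE// linearD. Qed.

Lemma D_dirN (v : V) f x : differentiable f x -> 'D_(- v) f x = - 'D_v f x.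
Proof. by move=> df; rewrite !deriveE// linearN. Qed.

End DirectionalDerivative.

Lemma D_mul (R : realType) (V : normedModType R) (f g : V -> R) x v :
  differentiable f x -> differentiable g x ->
  'D_v (fun z => f z * g z) x = f x * 'D_v g x + 'D_v f x * g x.
Proof. by move=> df dg; exact: (D_scale v df dg). Qed.

Section LinearMaps.
Variables (R : realType) (U V W : normedModType R).

Lemma differentiable_postlin (L : {linear V -> W}) (f : U -> V) x :
  continuous L -> differentiable f x -> differentiable (fun z => L (f z)) x.
Proof.
by move=> cL df; apply: differentiable_comp => //; exact: linear_differentiable.
Qed.

Lemma D_postlin (L : {linear V -> W}) (f : U -> V) x v :
  continuous L -> differentiable f x ->
  'D_v (fun z => L (f z)) x = L ('D_v f x).
Proof.
move=> cL df; have dL := linear_differentiable (f x) cL.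
rewrite !deriveE//; last exact: differentiable_postlin.
by rewrite (diff_comp df dL)/= diff_lin.
Qed.

Lemma D_prelin (L : {linear U -> V}) (f : V -> W) x v :
  continuous L -> differentiable f (L x) ->
  'D_v (fun z => f (L z)) x = 'D_(L v) f (L x).
Proof.
move=> cL df; have dL := linear_differentiable x cL.
rewrite !deriveE//; last exact: differentiable_comp.
by rewrite (diff_comp dL df)/= diff_lin.
Qed.

End LinearMaps.

Section Ck.
Variables (R : realType) (V : normedModType R).
Implicit Types (U : set V).

(** C^k regularity by recursion on the order, the form in which closure under
    the algebraic operations follows from the Leibniz rules by induction. *)
Fixpoint Ck (W : normedModType R) (k : nat) (U : set V) (f : V -> W) : Prop :=
  (forall z, U z -> differentiable f z) /\
  (if k is k'.+1 then forall v, Ck k' U (fun x => 'D_v f x) else True).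

Definition Cinf (W : normedModType R) (U : set V) (f : V -> W) : Prop :=
  forall k, Ck k U f.

Variables (W : normedModType R) (U : set V).
Hypothesis oU : open U.
Implicit Types (f g : V -> W) (k : nat).

Lemma Ck_diff k f z : Ck k U f -> U z -> differentiable f z.
Proof. by case: k => [|k] [H _] /H. Qed.

Lemma Ck_le k f : Ck k.+1 U f -> Ck k U f.
Proof.
elim: k f => [|k IH] f [df Df]; split=> // v.
by apply: IH; exact: Df.
Qed.

Lemma Ck_ext k f g : (forall z, U z -> f z = g z) -> Ck k U f -> Ck k U g.
Proof.
elim: k f g => [|k IH] f g fg [df Df].
  split=> // z Uz; apply: near_eq_differentiable (df z Uz).
  by apply: filterS (open_nbhs_nbhs (conj oU Uz)) => y /fg.
split=> [z Uz|v].
  apply: near_eq_differentiable (df z Uz).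
  by apply: filterS (open_nbhs_nbhs (conj oU Uz)) => y /fg.
by apply: IH (Df v) => z Uz; exact: D_open fg Uz.
Qed.

Lemma Ck_cst k (w : W) : Ck k U (fun=> w).
Proof.
elim: k w => [|k IH] w.
  by split=> // z _; exact: differentiable_cst.
split=> [z _|v]; first exact: differentiable_cst.
by apply: Ck_ext (IH 0) => z _; rewrite (derive_cst w).
Qed.

Lemma Ck_add k f g : Ck k U f -> Ck k U g -> Ck k U (fun z => f z + g z).
Proof.
elim: k f g => [|k IH] f g [df Df] [dg Dg].
  by split=> // z Uz; apply: differentiableD; [exact: df|exact: dg].
split=> [z Uz|v]; first by apply: differentiableD; [exact: df|exact: dg].
apply: Ck_ext (IH _ _ (Df v) (Dg v)) => z Uz.
by rewrite D_add//; [exact: df|exact: dg].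
Qed.

Lemma Ck_D k f v : Ck k.+1 U f -> Ck k U (fun x => 'D_v f x).
Proof. by move=> [_ Df]; exact: Df. Qed.

End Ck.

Section CkMore.
Variables (R : realType) (V W W' : normedModType R) (U : set V).
Hypothesis oU : open U.

Lemma Ck_lin k (L : {linear W -> W'}) (f : V -> W) :
  continuous L -> Ck k U f -> Ck k U (fun z => L (f z)).
Proof.
move=> cL; elim: k f => [|k IH] f [df Df].
  by split=> // z Uz; apply: differentiable_postlin => //; exact: df.
split=> [z Uz|v]; first by apply: differentiable_postlin => //; exact: df.
apply: Ck_ext (IH _ (Df v)) => // z Uz.
by rewrite D_postlin//; exact: df.
Qed.

Lemma Ck_scale k (f : V -> R) (g : V -> W) :
  Ck k U f -> Ck k U g -> Ck k U (fun z => f z *: g z).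
Proof.
elim: k f g => [|k IH] f g.
  move=> [df _] [dg _]; split=> // z Uz.
  have H := is_diff_scale (df _ Uz) (dg _ Uz); exact: ex_diff.
move=> Cf Cg; have [[df Df] [dg Dg]] := (Cf, Cg); split=> [z Uz|v].
  have H := is_diff_scale (df _ Uz) (dg _ Uz); exact: ex_diff.
apply: (@Ck_ext _ _ _ _ oU _ (fun x => f x *: 'D_v g x + 'D_v f x *: g x)).
  by move=> z Uz; rewrite D_scale//; [exact: df|exact: dg].
by apply: (Ck_add oU); apply: IH; [exact: Ck_le|exact: Dg|exact: Df|exact: Ck_le].
Qed.

End CkMore.

Section CkReal.
Variables (R : realType) (V : normedModType R) (U : set V).
Hypothesis oU : open U.

Lemma Ck_mul k (f g : V -> R) :
  Ck k U f -> Ck k U g -> Ck k U (fun z => f z * g z).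
Proof. by move=> Cf Cg; exact: (Ck_scale oU Cf Cg). Qed.

Lemma Ck_inv k (f : V -> R) : (forall z, U z -> f z != 0) ->
  Ck k U f -> Ck k U (fun z => (f z)^-1).
Proof.
move=> f0; elim: k => [|k IH].
  by move=> [df _]; split=> // z Uz; apply: differentiableV; [exact: df|exact: f0].
move=> Cf; have [df Df] := Cf; split=> [z Uz|v].
  by apply: differentiableV; [exact: df|exact: f0].
have Ci := IH (Ck_le Cf).
apply: (@Ck_ext _ _ _ _ oU _
  (fun z => (-1 : R) *: ((f z)^-1 * (f z)^-1 * 'D_v f z))).
  by move=> z Uz; rewrite (D_inv v (df _ Uz) (f0 _ Uz)) -[RHS]mulN1r.
apply: Ck_scale => //; first exact: Ck_cst.
by apply: Ck_mul; [exact: Ck_mul|exact: Df].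
Qed.

Lemma Ck_id k : Ck k U (fun z => z).
Proof.
have did z : differentiable (fun z : V => z) z.
  have H := is_diff_id z; exact: ex_diff.
case: k => [|k]; split=> // v.
by apply: Ck_ext (Ck_cst oU k v) => // z _; rewrite (derive_id z v).
Qed.

End CkReal.

(** * Symmetry of second derivatives *)

Section Schwarz.
Variables (R : realType) (V : normedModType R).
Implicit Types (f : V -> R) (z p u v : V).

Lemma line_is_derive f p u (s : R) : differentiable f (p + s *: u) ->
  is_derive s 1 (fun t : R => f (p + t *: u)) ('D_u f (p + s *: u)).
Proof.
move=> df.
have E : (fun h : R => h^-1 *: (((fun t : R => f (p + t *: u)) \o shift s)
    (h *: 1) - f (p + s *: u))) =
  (fun h : R => h^-1 *: ((f \o shift (p + s *: u)) (h *: u) - f (p + s *: u))).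
  apply/funext => h /=; congr (_ *: (f _ - _)).
  by rewrite [h *: 1]mulr1 scalerDl addrCA.
apply: DeriveDef; rewrite /derivable /derive E //.
have := @diff_derivable _ _ _ f (p + s *: u) u df; exact.
Qed.

Lemma mvt_line (f df : R -> R) (h : R) : 0 < h ->
  (forall s, 0 <= s <= h -> is_derive s 1 f (df s)) ->
  exists2 s, 0 <= s <= h & f h - f 0 = h * df s.
Proof.
move=> h0 fdf.
have [x||c + E] := @MVT R f df 0 h h0.
- by rewrite in_itv/= => /andP[a b]; apply: fdf; rewrite !ltW.
- apply: derivable_within_continuous => x; rewrite in_itv/= => xh.
  by have [] := fdf x xh.
- rewrite in_itv/= => /andP[a b]; exists c; first by rewrite !ltW.
  by rewrite E subr0 mulrC.
Qed.

Let Delta f z u v (h : R) : R :=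
  f (z + h *: u + h *: v) - f (z + h *: u) - (f (z + h *: v) - f z).

(* The mean value theorem in the direction u, applied to the difference of f
   along v, and then in the direction v. *)
Let second_difference_mvt f z u v (h : R) : 0 < h ->
  (forall s t, 0 <= s <= h -> 0 <= t <= h ->
    differentiable f (z + s *: u + t *: v) /\
    differentiable (fun x => 'D_u f x) (z + s *: u + t *: v)) ->
  exists s t, [/\ 0 <= s <= h, 0 <= t <= h &
    Delta f z u v h = h * (h * 'D_v (fun x => 'D_u f x) (z + s *: u + t *: v))].
Proof.
move=> h0 H.
have hh : 0 <= h <= h by rewrite ltW/=.
have h00 : 0 <= (0 : R) <= h by rewrite lexx ltW.
have [s sh E1] : exists2 s, 0 <= s <= h & Delta f z u v h =
    h * ('D_u f (z + s *: u + h *: v) - 'D_u f (z + s *: u)).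
  have fd s : 0 <= s <= h -> is_derive s 1
      (fun s : R => f (z + h *: v + s *: u) - f (z + s *: u))
      ('D_u f (z + h *: v + s *: u) - 'D_u f (z + s *: u)).
    move=> sh; apply: is_deriveB; apply: line_is_derive.
      by rewrite addrAC; have [] := H s h sh hh.
    by have [] := H s 0 sh h00; rewrite scale0r addr0.
  have [s sh] := mvt_line h0 fd.
  rewrite scale0r !addr0 => E; exists s => //.
  by rewrite /Delta [z + _ + h *: v]addrAC E [z + _ + s *: u]addrAC.
have [t th E2] := @mvt_line (fun t => 'D_u f (z + s *: u + t *: v))
  (fun t => 'D_v (fun x => 'D_u f x) (z + s *: u + t *: v)) h h0
  (fun t th => line_is_derive (H s t sh th).2).
exists s, t; split=> //.
by rewrite E1; congr (h * _); rewrite -E2 scale0r addr0.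
Qed.

Let second_difference_cvg (U : set V) f z u v : open U -> U z -> Ck 2 U f ->
  (h^-1 * (h^-1 * Delta f z u v h)) @[h --> 0^'+] -->
    'D_v (fun x => 'D_u f x) z.
Proof.
move=> oU Uz Cf.
have df y : U y -> differentiable f y by exact: Ck_diff Cf.
have C1 : Ck 1 U (fun x => 'D_u f x) by exact: Ck_D Cf.
have dDf y : U y -> differentiable (fun x => 'D_u f x) y by exact: Ck_diff C1.
set A := fun x => 'D_v (fun y => 'D_u f y) x.
have cA : {for z, continuous A}.
  by apply: differentiable_continuous; apply: (Ck_diff (Ck_D v C1)).
apply/cvgrPdist_lt => e e0.
have : \forall y \near z, U y /\ `|A z - A y| < e.
  near=> y; split; near: y; first exact: open_nbhs_nbhs.
  by move/cvgrPdist_lt : cA; exact.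
move=> /nbhs_ballP[d /= d0 Hd].
(* for h (1 + |u| + |v|) < d the parallelogram z + [0, h] u + [0, h] v lies
   in the ball of radius d; the summand 1 only makes the bound positive *)
have B0 : 0 < 1 + `|u| + `|v|.
  by rewrite -addrA; apply: ltr_pwDl => //; exact: addr_ge0.
near=> h.
have h0 : 0 < h by near: h; exact: nbhs_right_gt.
have hd : h * (1 + `|u| + `|v|) < d.
  rewrite -ltr_pdivlMr//; near: h; apply: nbhs_right_lt; exact: divr_gt0.
have inb s t : 0 <= s <= h -> 0 <= t <= h -> ball z d (z + s *: u + t *: v).
  move=> /andP[s0 sh] /andP[t0 th].
  rewrite -ball_normE/= -addrA opprD addrA subrr add0r normrN.
  apply: le_lt_trans (ler_normD _ _) _; rewrite !normrZ !ger0_norm//.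
  apply: le_lt_trans _ hd; rewrite -addrA mulrDr mulrDr mulr1.
  apply: le_trans (_ : h * `|u| + h * `|v| <= _).
    by apply: lerD; apply: ler_wpM2r.
  by rewrite lerDr ltW.
have [s [t [sh th ->]]] := @second_difference_mvt f z u v h h0 (fun s t sh th =>
  conj (df _ (Hd _ (inb s t sh th)).1) (dDf _ (Hd _ (inb s t sh th)).1)).
rewrite !mulKf ?gt_eqF//.
by have [] := Hd _ (inb s t sh th).
Unshelve. all: by end_near. Qed.

(** Both mixed derivatives are the limit of the second difference quotient
    h^-2 (f (z + hu + hv) - f (z + hu) - f (z + hv) + f z), which is symmetric
    in u and v. *)
Lemma schwarz_real (U : set V) f z u v : open U -> U z -> Ck 2 U f ->
  'D_v (fun x => 'D_u f x) z = 'D_u (fun x => 'D_v f x) z.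
Proof.
move=> oU Uz Cf.
have E : (fun h => h^-1 * (h^-1 * Delta f z u v h)) =
         (fun h => h^-1 * (h^-1 * Delta f z v u h)).
  apply/funext => h; congr (_ * (_ * _)).
  by rewrite /Delta [z + h *: v + _]addrAC; ring.
have := cvg_lim (@Rhausdorff R) (@second_difference_cvg U f z u v oU Uz Cf).
rewrite E => <-.
apply: (cvg_lim (@Rhausdorff R)).
exact: (@second_difference_cvg U f z v u oU Uz Cf).
Qed.

End Schwarz.

(** * Real coordinates of C^n and the bracket of vector fields *)

Section RealCoordinates.
Variables (R : realType) (n : nat).
Local Notation V := (Cn R n).
Implicit Types (i : bool * 'I_n) (v w : V) (a : 'rV[R[i]]_n).

(** [co (false, j)] and [co (true, j)] are the real and imaginary parts of the
    j-th complex coordinate. *)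
Definition co i v : R := if i.1 then v.2 0 i.2 else v.1 0 i.2.

Definition be i : V :=
  if i.1 then (0, delta_mx 0 i.2) else (delta_mx 0 i.2, 0).

Lemma co_inj v w : (forall i, co i v = co i w) -> v = w.
Proof.
case: v w => [v1 v2] [w1 w2] H; congr (_, _); apply/rowP => j.
- exact: (H (false, j)).
- exact: (H (true, j)).
Qed.

Lemma co_is_linear i : linear (co i).
Proof. by case: i => -[] j k v w; rewrite /co /= !mxE. Qed.

HB.instance Definition _ i :=
  GRing.isLinear.Build R V R *%R (co i) (co_is_linear i).

Lemma coD i v w : co i (v + w) = co i v + co i w.
Proof. exact: linearD. Qed.

Lemma coN i v : co i (- v) = - co i v.
Proof. exact: linearN. Qed.

Lemma coZ i k v : co i (k *: v) = k * co i v.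
Proof. exact: linearZ. Qed.

Lemma co0 i : co i 0 = 0.
Proof. exact: linear0. Qed.

Definition coE := (coD, coN, coZ, co0).

Lemma co_be i j : co i (be j) = (i == j)%:R.
Proof.
case: i j => [b i] [c j]; rewrite /co /be xpair_eqE/=.
by case: b; case: c; rewrite /= !mxE.
Qed.

Lemma be_sum v : v = \sum_i co i v *: be i.
Proof.
apply: co_inj => j; rewrite linear_sum (bigD1 j)//= coZ co_be eqxx mulr1.
by rewrite big1 ?addr0// => i ij; rewrite coZ co_be eq_sym (negPf ij) mulr0.
Qed.

Lemma co_continuous i : continuous (co i).
Proof.
move=> v; rewrite /co; case: i => -[] j /=.
- by apply: (@cvg_comp _ _ _ snd (fun w : 'rV[R]_n => w 0 j) _ (nbhs v.2));
    [exact: cvg_snd | exact: coord_continuous].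
- by apply: (@cvg_comp _ _ _ fst (fun w : 'rV[R]_n => w 0 j) _ (nbhs v.1));
    [exact: cvg_fst | exact: coord_continuous].
Qed.

Lemma linear_be (W : lmodType R) (L : {linear V -> W}) v :
  L v = \sum_i co i v *: L (be i).
Proof.
by rewrite [in LHS](be_sum v) linear_sum; apply: eq_bigr => i _; rewrite linearZ.
Qed.

Lemma lin_continuous (W : normedModType R) (L : {linear V -> W}) : continuous L.
Proof.
have -> : (L : V -> W) = (fun v => \sum_i co i v *: L (be i)).
  by apply/funext => v; exact: linear_be.
apply: continuous_big => [|i _]; first exact: add_continuous.
by move=> v; apply: cvgZr_tmp; exact: co_continuous.
Qed.

End RealCoordinates.
Arguments be {R n} i.

Section SmoothOn.
Variables (R : realType) (n : nat).
Local Notation V := (Cn R n).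

Lemma smooth_onP (W : normedModType R) (U : set V) (f : V -> W) :
  smooth_on U f <-> Cinf U f.
Proof.
split=> [H k|H vs].
  elim: k f H => [|k IH] f H; first by split=> // z Uz; exact: (H [::]).
  split=> [z Uz|v]; first exact: (H [::]).
  apply: IH => vs z Uz; have := H (rcons vs v) z Uz.
  by rewrite foldr_rcons.
elim/last_ind: vs f H => [|vs v IH] f H z Uz; first exact: Ck_diff (H 0%N) Uz.
by rewrite foldr_rcons; apply: IH => // k; apply: Ck_D; exact: H.
Qed.

End SmoothOn.

Section BasisDerivatives.
Variables (R : realType) (n : nat).
Local Notation V := (Cn R n).
Variables (U : set V).
Hypothesis oU : open U.

Lemma D_be (W : normedModType R) (f : V -> W) v z : differentiable f z ->
  'D_v f z = \sum_i co i v *: 'D_(be i) f z.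
Proof.
move=> df; rewrite deriveE// linear_be.
by apply: eq_bigr => i _; rewrite deriveE.
Qed.

Lemma Ck_sum (W : normedModType R) (I : finType) k (F : I -> V -> W) :
  (forall i, Ck k U (F i)) -> Ck k U (fun z => \sum_i F i z).
Proof.
move=> H; rewrite (_ : (fun z => _) = \sum_i F i); last first.
  by apply/funext => z; rewrite fct_sumE.
elim/big_ind : _ => //; first exact: (Ck_cst oU k (0 : W)).
by move=> f g; exact: Ck_add.
Qed.

Lemma Cinf_D (W : normedModType R) (X : V -> V) (f : V -> W) :
  Cinf U X -> Cinf U f -> Cinf U (fun z => 'D_(X z) f z).
Proof.
move=> CX Cf k.
apply: (@Ck_ext _ _ _ _ oU _ (fun z => \sum_i co i (X z) *: 'D_(be i) f z)).
  by move=> z Uz; rewrite [RHS]D_be//; exact: Ck_diff (Cf 0%N) Uz.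
apply: Ck_sum => i; apply: (Ck_scale oU); last exact: (Ck_D (be i) (Cf k.+1)).
by apply: Ck_lin => //; exact: co_continuous.
Qed.

Lemma D_sum (W : normedModType R) (I : finType) (F : I -> V -> W) v z :
  (forall i, differentiable (F i) z) ->
  'D_v (fun z => \sum_i F i z) z = \sum_i 'D_v (F i) z.
Proof.
move=> H; rewrite (_ : (fun z => _) = \sum_i F i); last first.
  by apply/funext => x; rewrite fct_sumE.
suff [] : differentiable (\sum_i F i) z /\
    'D_v (\sum_i F i) z = \sum_i 'D_v (F i) z by [].
elim/big_rec2 : _ => [|i w f _ [df <-]].
  by split; [exact: (differentiable_cst (0 : W) z) | exact: (derive_cst (0 : W) z v)].
by split; [exact: differentiableD | exact: D_add].
Qed.

(** The product rule for the pairing of a direction that varies with the point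
    and the differential of f; the last term is a second derivative of f in
    fixed directions. *)
Lemma D_D (W : normedModType R) (Y : V -> V) (f : V -> W) v z :
  U z -> Cinf U Y -> Cinf U f ->
  'D_v (fun x => 'D_(Y x) f x) z =
  'D_('D_v Y z) f z + 'D_v (fun x => 'D_(Y z) f x) z.
Proof.
move=> Uz CY Cf.
have df x : U x -> differentiable f x by move=> Ux; exact: Ck_diff (Cf 0%N) Ux.
have dDf u : differentiable (fun x => 'D_u f x) z.
  exact: Ck_diff (Ck_D u (Cf 1%N)) Uz.
have dY : differentiable Y z by exact: Ck_diff (CY 0%N) Uz.
have dc i : differentiable (fun x => co i (Y x)) z.
  by apply: differentiable_postlin => //; exact: co_continuous.
have E1 : 'D_v (fun x => 'D_(Y x) f x) z =
    'D_v (fun x => \sum_i co i (Y x) *: 'D_(be i) f x) z.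
  by apply: (D_open _ oU) Uz => x Ux; apply: D_be; exact: df.
have E2 : 'D_v (fun x => 'D_(Y z) f x) z =
    'D_v (fun x => \sum_i co i (Y z) *: 'D_(be i) f x) z.
  by apply: (D_open _ oU) Uz => x Ux; apply: D_be; exact: df.
apply: (etrans E1); apply/esym.
apply: (etrans (congr1 (fun w => 'D_('D_v Y z) f z + w) E2)); apply/esym.
move=> {E1 E2}.
rewrite D_sum; last first.
  by move=> i; have H := is_diff_scale (dc i) (dDf (be i)); exact: ex_diff.
rewrite D_sum; last first.
  move=> i; have dY0 := differentiable_cst (co i (Y z)) z.
  have H := is_diff_scale dY0 (dDf (be i)).
  exact: ex_diff.
rewrite (D_be _ (df z Uz)) -big_split/=; apply: eq_bigr => i _.
rewrite D_scale// addrC D_postlin//; last exact: co_continuous.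
rewrite (D_scale _ (differentiable_cst (co i (Y z)) z) (dDf (be i))).
by rewrite (derive_cst (co i (Y z))) scale0r addr0.
Qed.

(** The Lie bracket acts on functions as the commutator of derivations; this is
    the symmetry of second derivatives. *)
Lemma D_bracket_real (X Y : V -> V) (f : V -> R) z :
  U z -> Cinf U X -> Cinf U Y -> Cinf U f ->
  'D_(X z) (fun x => 'D_(Y x) f x) z - 'D_(Y z) (fun x => 'D_(X x) f x) z
  = 'D_(bracket X Y z) f z.
Proof.
move=> Uz CX CY Cf; have HX := D_D (X z) Uz CY Cf.
have HY := D_D (Y z) Uz CX Cf.
have S := @schwarz_real _ _ U f z (X z) (Y z) oU Uz (Cf 2%N).
apply: (etrans (congr2 (fun a b => a - b) HX
  (etrans HY (congr1 (fun c => 'D_('D_(Y z) X z) f z + c) S)))).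
move=> {HX HY S}.
have df : differentiable f z by exact: Ck_diff (Cf 0%N) Uz.
have E : 'D_(bracket X Y z) f z =
    'D_('D_(X z) Y z) f z - 'D_('D_(Y z) X z) f z.
  exact: etrans (D_dirD _ _ df) (congr1 _ (D_dirN _ df)).
apply: (etrans _ (esym E)).
have cancel (p a b : R) : a + p - (b + p) = a - b by ring.
exact: cancel.
Qed.

(** The same identity for vector-valued Z, coordinate by coordinate. *)
Lemma D_bracket (X Y Z : V -> V) z :
  U z -> Cinf U X -> Cinf U Y -> Cinf U Z ->
  'D_(X z) (fun x => 'D_(Y x) Z x) z - 'D_(Y z) (fun x => 'D_(X x) Z x) z
  = 'D_(bracket X Y z) Z z.
Proof.
move=> Uz CX CY CZ; apply: co_inj => i.
have dC (F : V -> V) x : Cinf U F -> U x -> differentiable F x.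
  by move=> CF Ux; exact: Ck_diff (CF 0%N) Ux.
have Dco (F : V -> V) v x : Cinf U F -> U x ->
    'D_v (fun y => co i (F y)) x = co i ('D_v F x).
  by move=> CF Ux; rewrite D_postlin//; [exact: co_continuous|exact: dC].
have Cco (F : V -> V) : Cinf U F -> Cinf U (fun y => co i (F y)).
  by move=> CF k; apply: Ck_lin => //; exact: co_continuous.
have E (F G : V -> V) : Cinf U F -> Cinf U G ->
    co i ('D_(F z) (fun x => 'D_(G x) Z x) z) =
    'D_(F z) (fun x => 'D_(G x) (fun y => co i (Z y)) x) z.
  move=> CF CG; apply: (etrans (esym (Dco _ _ _ (Cinf_D CG CZ) Uz))).
  by apply: (D_open _ oU) Uz => x Ux; exact: esym (Dco Z (G x) x CZ Ux).
have coB (A B C : V) p r : co i A = p -> co i B = r -> p - r = co i C ->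
    co i (A - B) = co i C.
  by move=> <- <- <-; rewrite coD coN.
apply: (coB _ _ _ _ _ (E X Y CX CY) (E Y X CY CX)).
apply: (etrans (D_bracket_real Uz CX CY (Cco _ CZ))).
exact: Dco.
Qed.

End BasisDerivatives.

(** * The flat inner product and the metric g(alpha, beta) *)

Section InnerProduct.
Variables (R : realType) (n : nat).
Local Notation V := (Cn R n).
Implicit Types (v w u z : V) (a : 'rV[R[i]]_n) (k : R).

Lemma sum_coords (A : nmodType) (F : bool * 'I_n -> A) :
  \sum_i F i = \sum_j (F (true, j) + F (false, j)).
Proof.
rewrite (eq_bigr (fun p => F (p.1, p.2))); last by case.
rewrite -(pair_bigA _ (fun b j => F (b, j)))/= exchange_big/=.
by apply: eq_bigr => j _; rewrite big_bool.
Qed.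

Lemma Jst_is_linear : linear (@Jst R n).
Proof.
by move=> k [v1 v2] [w1 w2]; rewrite /Jst; congr (_, _) => /=;
  rewrite ?scalerN ?opprD.
Qed.

HB.instance Definition _ :=
  GRing.isLinear.Build R V V *:%R (@Jst R n) Jst_is_linear.

Lemma JD v w : Jst (v + w) = Jst v + Jst w. Proof. exact: linearD. Qed.
Lemma JN v : Jst (- v) = - Jst v. Proof. exact: linearN. Qed.
Lemma JZ k v : Jst (k *: v) = k *: Jst v. Proof. exact: linearZ. Qed.
Lemma JJ v : Jst (Jst v) = - v. Proof. by case: v. Qed.

Lemma coJ i v : co i (Jst v) =
  if i.1 then co (false, i.2) v else - co (true, i.2) v.
Proof. by case: i => -[] j; rewrite /co/= ?mxE. Qed.

(** The real part of the flat Hermitian product of C^n. *)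
Definition q v w : R := \sum_i co i v * co i w.

Lemma qC v w : q v w = q w v.
Proof. by apply: eq_bigr => i _; rewrite mulrC. Qed.

Lemma qDl u v w : q (u + v) w = q u w + q v w.
Proof. by rewrite -big_split/=; apply: eq_bigr => i _; rewrite coD mulrDl. Qed.

Lemma qZl k v w : q (k *: v) w = k * q v w.
Proof. by rewrite mulr_sumr; apply: eq_bigr => i _; rewrite coZ mulrA. Qed.

Lemma qNl v w : q (- v) w = - q v w.
Proof. by rewrite -scaleN1r qZl mulN1r. Qed.

Lemma qDr u v w : q w (u + v) = q w u + q w v.
Proof. by rewrite qC qDl ![q _ w]qC. Qed.

Lemma qZr k v w : q w (k *: v) = k * q w v.
Proof. by rewrite qC qZl qC. Qed.

Lemma qNr v w : q w (- v) = - q w v.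
Proof. by rewrite qC qNl qC. Qed.

Lemma qJl v w : q (Jst v) w = - q v (Jst w).
Proof.
rewrite /q !sum_coords -sumrN; apply: eq_bigr => j _.
by rewrite !coJ/=; ring.
Qed.

Lemma q_ge0 v : 0 <= q v v.
Proof. by apply: sumr_ge0 => i _; rewrite -expr2 sqr_ge0. Qed.

Lemma q_eq0 v : q v v = 0 -> v = 0.
Proof.
move=> /eqP; rewrite psumr_eq0; last by move=> i _; rewrite -expr2 sqr_ge0.
move=> /allP H; apply: co_inj => i; rewrite co0.
by have := H i (mem_index_enum i); rewrite /= mulf_eq0 orbb => /eqP.
Qed.

Lemma q_neq0 z : punctured z -> q z z != 0.
Proof.
by move=> z0; apply/eqP => /q_eq0 z00; rewrite /punctured/= z00 eqxx in z0.
Qed.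

Lemma open_punctured : open (@punctured R n).
Proof.
rewrite (_ : @punctured R n = ~` [set 0]).
  apply: closed_openC; apply: accessible_closed_set1.
  by apply: hausdorff_accessible; exact: norm_hausdorff.
by apply/seteqP; split => z /= /eqP.
Qed.

Lemma co_hopf_re a j v : co (false, j) (hopf a v) =
  complex.Re (a 0 j) * co (false, j) v - complex.Im (a 0 j) * co (true, j) v.
Proof. by rewrite /co /hopf /ofC /toC /= !mxE; case: (a 0 j). Qed.

Lemma co_hopf_im a j v : co (true, j) (hopf a v) =
  complex.Re (a 0 j) * co (true, j) v + complex.Im (a 0 j) * co (false, j) v.
Proof. by rewrite /co /hopf /ofC /toC /= !mxE; case: (a 0 j). Qed.

Lemma hopf_is_linear a : linear (hopf a : V -> V).
Proof.
move=> k v w; apply: co_inj => -[[] j];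
  by rewrite coD coZ ?co_hopf_re ?co_hopf_im !coD !coZ; ring.
Qed.

HB.instance Definition _ a :=
  GRing.isLinear.Build R V V *:%R (hopf a) (hopf_is_linear a).

Lemma hopfD a v w : hopf a (v + w) = hopf a v + hopf a w.
Proof. exact: linearD. Qed.
Lemma hopfN a v : hopf a (- v) = - hopf a v.
Proof. exact: linearN. Qed.
Lemma hopfZ a k v : hopf a (k *: v) = k *: hopf a v.
Proof. exact: linearZ. Qed.

Lemma hopfJ a v : hopf a (Jst v) = Jst (hopf a v).
Proof.
apply: co_inj => -[[] j];
  by rewrite coJ/= ?co_hopf_re ?co_hopf_im !coJ/=; ring.
Qed.

(** The deck transformation multiplies every complex coordinate by a number of
    the same modulus, so it is a similarity of the flat metric. *)
Lemma hopf_q a rho v w :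
  (forall j, complex.Re (a 0 j) ^+ 2 + complex.Im (a 0 j) ^+ 2 = rho) ->
  q (hopf a v) (hopf a w) = rho * q v w.
Proof.
move=> H; rewrite /q !sum_coords mulr_sumr; apply: eq_bigr => j _.
by rewrite !co_hopf_re !co_hopf_im -(H j); ring.
Qed.

End InnerProduct.

Section MetricInRealTerms.
Variables (R : realType) (n : nat).
Local Notation V := (Cn R n).
Implicit Types (v w u z : V).

Definition herm v w : R[i] := \sum_j toC v 0 j * conjc (toC w 0 j).

Lemma hermE v w : herm v w = (q v w +i* q v (Jst w))%C.
Proof.
rewrite /herm /q !sum_coords.
have -> : \sum_j toC v 0 j * conjc (toC w 0 j) = \sum_j
    ((co (true, j) v * co (true, j) w + co (false, j) v * co (false, j) w) +i*
     (co (true, j) v * co (true, j) (Jst w)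
      + co (false, j) v * co (false, j) (Jst w)))%C.
  apply: eq_bigr => j _; rewrite !coJ /= /toC !mxE /co/=.
  by apply/eqP; rewrite eq_complex/=; apply/andP; split; apply/eqP; ring.
elim/big_ind3 : _ => //.
by move=> x1 x2 x3 y1 y2 y3 -> ->.
Qed.

Lemma sqnormE z : sqnorm z = (q z z)%:C%C.
Proof.
have -> : sqnorm z = herm z z by apply: eq_bigr => j _; rewrite sqr_normc.
rewrite hermE; congr (_ +i* _)%C.
have : q z (Jst z) = - q z (Jst z) by rewrite -qJl qC.
lra.
Qed.

(** The real and imaginary parts of (v, z) are q(v, z) and q(v, Jz), so this is
    twice the real part of alpha (v, w) / |z|^2 + beta (v, z) (z, w) / |z|^4. *)
Lemma hopf_metricE alpha beta z v w : hopf_metric alpha beta z v w =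
  2 * (alpha * (q v w / q z z) + beta *
    (q v z / q z z * (q w z / q z z) + q v (Jst z) / q z z * (q w (Jst z) / q z z))).
Proof.
rewrite /hopf_metric; congr (2 * _).
have -> : \sum_i \sum_j hopf_coef alpha beta z i j * toC v 0 i * conjc (toC w 0 j)
    = alpha%:C%C * herm v w / sqnorm z
      + beta%:C%C * herm v z * conjc (herm w z) / sqnorm z ^+ 2.
  have -> : conjc (herm w z) = herm z w.
    rewrite /herm rmorph_sum/=; apply: eq_bigr => j _.
    by rewrite rmorphM/= conjcK mulrC.
  rewrite /herm -[beta%:C%C * _ * _]mulrA big_distrlr/=.
  rewrite !(mulr_sumr, mulr_suml) -big_split/=; apply: eq_bigr => i _.
  rewrite !(mulr_sumr, mulr_suml).
  have alg (A B s r v1 w1 v2 z1 z2 d : R[i]) :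
      (A * d / s + B * z1 * z2 / r) * v1 * w1
      = A * d * (v1 * w1) / s + B * (v1 * z1 * (z2 * w1)) / r by ring.
  rewrite (bigD1 i)//= [X in _ = _ + X](bigD1 i)//= addrA; congr (_ + _).
    by rewrite /hopf_coef eqxx alg// mulr1.
  apply: eq_bigr => j ji; rewrite /hopf_coef eq_sym (negPf ji) alg//.
  by rewrite mulr0 !mul0r add0r.
have key (A B t p1 p2 x1 x2 y1 y2 : R) :
    complex.Re (A%:C%C * (p1 +i* p2)%C * t%:C%C
      + B%:C%C * (x1 +i* x2)%C * conjc (y1 +i* y2)%C * t%:C%C ^+ 2)
    = A * (p1 * t) + B * (x1 * t * (y1 * t) + x2 * t * (y2 * t)).
  by rewrite expr2 /=; ring.
by rewrite !hermE sqnormE -exprVn -fmorphV key.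
Qed.

End MetricInRealTerms.

(** * Invariant functions and vector fields *)

Definition hasD (R : realType) (V W : normedModType R) (f : V -> W) (z v : V)
  (d : W) := differentiable f z /\ 'D_v f z = d.

Section HasDerivative.
Variables (R : realType) (V W : normedModType R).
Implicit Types (z v : V).

Lemma hasD_cst (c : W) z v : hasD (fun=> c) z v 0.
Proof. by split; [exact: differentiable_cst | exact: derive_cst]. Qed.

Lemma hasD_add (f g : V -> W) z v d e :
  hasD f z v d -> hasD g z v e -> hasD (fun x => f x + g x) z v (d + e).
Proof.
by move=> [df <-] [dg <-]; split; [exact: differentiableD | exact: D_add].
Qed.

Lemma hasD_opp (f : V -> W) z v d :
  hasD f z v d -> hasD (fun x => - f x) z v (- d).
Proof.
by move=> [df <-]; split; [exact: differentiableN | exact: D_opp].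
Qed.

Lemma hasD_scale (f : V -> R) (g : V -> W) z v d e :
  hasD f z v d -> hasD g z v e ->
  hasD (fun x => f x *: g x) z v (f z *: e + d *: g z).
Proof.
move=> [df <-] [dg <-]; split; last exact: D_scale.
have H := is_diff_scale df dg; exact: ex_diff.
Qed.

Lemma hasD_eq (f : V -> W) z v d e : hasD f z v d -> d = e -> hasD f z v e.
Proof. by move=> H <-. Qed.

End HasDerivative.

Section HasRealDerivative.
Variables (R : realType) (V : normedModType R).
Implicit Types (f g : V -> R) (z v : V) (d e : R).

Lemma hasD_mul f g z v d e : hasD f z v d -> hasD g z v e ->
  hasD (fun x => f x * g x) z v (f z * e + d * g z).
Proof.
by move=> [df <-] [dg <-]; split; [exact: differentiableM | exact: D_mul].
Qed.

Lemma hasD_mulc c f z v d : hasD f z v d -> hasD (fun x => c * f x) z v (c * d).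
Proof.
by move=> H; have := hasD_mul (hasD_cst c z v) H; rewrite mul0r addr0.
Qed.

Lemma hasD_inv f z v d : f z != 0 -> hasD f z v d ->
  hasD (fun x => (f x)^-1) z v (- ((f z)^-1 * (f z)^-1 * d)).
Proof.
by move=> f0 [df <-]; split; [exact: differentiableV | exact: D_inv].
Qed.

End HasRealDerivative.

Section InvariantFields.
Variables (R : realType) (n : nat) (a : 'rV[R[i]]_n) (rho : R).
Local Notation V := (Cn R n).
Local Notation vf := (is_vfield a).
Local Notation fn := (is_function a).
Local Notation P := (@punctured R n).
Implicit Types (X Y Z : V -> V) (f : V -> R) (z v w : V).

Hypothesis a_rho :
  forall j, complex.Re (a 0 j) ^+ 2 + complex.Im (a 0 j) ^+ 2 = rho.
Hypothesis rho0 : rho != 0.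

Let oP : open P := @open_punctured R n.
Hint Resolve oP : core.

Lemma hopf_punctured z : P z -> P (hopf a z).
Proof.
move=> Pz; apply/eqP => h0; have := hopf_q z z a_rho.
rewrite h0 /q big1 => [/esym/eqP|i _]; last by rewrite co0 mul0r.
by rewrite mulf_eq0 (negPf rho0) (negPf (q_neq0 Pz)).
Qed.

Lemma vf_C X : vf X -> Cinf P X.
Proof. by move=> [/smooth_onP]. Qed.

Lemma fn_C f : fn f -> Cinf P f.
Proof. by move=> [/smooth_onP]. Qed.

Lemma vf_diff X z : vf X -> P z -> differentiable X z.
Proof. by move=> /vf_C C Pz; exact: Ck_diff (C 0%N) Pz. Qed.

Lemma fn_diff f z : fn f -> P z -> differentiable f z.
Proof. by move=> /fn_C C Pz; exact: Ck_diff (C 0%N) Pz. Qed.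

Lemma vf_add X Y : vf X -> vf Y -> vf (fun z => X z + Y z).
Proof.
move=> vX vY; split.
  by apply/smooth_onP => k; apply: Ck_add => //; exact: vf_C.
by move=> z Pz; rewrite (vX.2 z Pz) (vY.2 z Pz); exact: esym (hopfD _ _ _).
Qed.

Lemma vf_scale f X : fn f -> vf X -> vf (fun z => f z *: X z).
Proof.
move=> vf vX; split.
  by apply/smooth_onP => k; apply: Ck_scale => //; [exact: fn_C | exact: vf_C].
by move=> z Pz; rewrite (vf.2 z Pz) (vX.2 z Pz); exact: esym (hopfZ _ _ _).
Qed.

Lemma vf_lin (L : {linear V -> V}) X :
  (forall v, L (hopf a v) = hopf a (L v)) -> vf X -> vf (fun z => L (X z)).
Proof.
move=> La vX; split.
  by apply/smooth_onP => k; apply: Ck_lin => //; [exact: lin_continuous | exact: vf_C].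
by move=> z Pz; rewrite vX.2// La.
Qed.

Lemma vf_J X : vf X -> vf (fun z => Jst (X z)).
Proof. by apply: vf_lin => v; rewrite hopfJ. Qed.

Lemma vf_opp X : vf X -> vf (fun z => - X z).
Proof. by apply: (@vf_lin -%R) => v; exact: esym (hopfN _ _). Qed.

Lemma vf_sub X Y : vf X -> vf Y -> vf (fun z => X z - Y z).
Proof. by move=> vX vY; apply: vf_add => //; exact: vf_opp. Qed.

Lemma vf_id : vf (fun z => z).
Proof. by split=> //; apply/smooth_onP => k; exact: Ck_id. Qed.

Lemma vf_D X Y : vf X -> vf Y -> vf (fun z => 'D_(X z) Y z).
Proof.
move=> vX vY; split.
  by apply/smooth_onP; apply: Cinf_D => //; exact: vf_C.
move=> z Pz; rewrite vX.2//.
have ca := @lin_continuous R n _ (hopf a).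
apply: etrans (esym (D_prelin (X z) ca (vf_diff vY (hopf_punctured Pz)))) _.
apply: etrans (D_postlin (X z) ca (vf_diff vY Pz)).
by apply: (D_open _ oP) Pz => x; exact: vY.2.
Qed.

Lemma fn_D X f : vf X -> fn f -> fn (fun z => 'D_(X z) f z).
Proof.
move=> vX ff; split.
  by apply/smooth_onP; apply: Cinf_D => //; [exact: vf_C | exact: fn_C].
move=> z Pz; rewrite vX.2//.
have ca := @lin_continuous R n _ (hopf a).
apply: etrans (esym (D_prelin (X z) ca (fn_diff ff (hopf_punctured Pz)))) _.
by apply: (D_open _ oP) Pz => x; exact: ff.2.
Qed.

Lemma vf_bracket X Y : vf X -> vf Y -> vf (bracket X Y).
Proof. by move=> vX vY; apply: vf_sub; exact: vf_D. Qed.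

Lemma fn_cst c : fn (fun=> c).
Proof. by split=> //; apply/smooth_onP => k; exact: Ck_cst. Qed.

Lemma fn_add f g : fn f -> fn g -> fn (fun z => f z + g z).
Proof.
move=> ff fg; split; last by move=> z Pz; rewrite ff.2// fg.2.
by apply/smooth_onP => k; apply: Ck_add => //; exact: fn_C.
Qed.

Lemma fn_mul f g : fn f -> fn g -> fn (fun z => f z * g z).
Proof.
move=> ff fg; split; last by move=> z Pz; rewrite ff.2// fg.2.
by apply/smooth_onP => k; apply: Ck_mul => //; exact: fn_C.
Qed.

(** The flat inner product rescaled to be invariant under the deck group; the
    metrics g(alpha, beta) are polynomial in it. *)
Definition br z v w : R := q v w / q z z.

Lemma fn_br X Y : vf X -> vf Y -> fn (fun z => br z (X z) (Y z)).
Proof.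
move=> vX vY; split; last first.
  move=> z Pz; rewrite /br vX.2// vY.2// !(hopf_q _ _ a_rho).
  by rewrite invfM mulrACA divff// mul1r.
have Cq X' Y' : Cinf P X' -> Cinf P Y' -> Cinf P (fun z => q (X' z) (Y' z)).
  move=> CX CY k; apply: Ck_sum => // i.
  by apply: Ck_mul => //; apply: Ck_lin => //; exact: co_continuous.
apply/smooth_onP => k; apply: Ck_mul => //; first by apply: Cq; exact: vf_C.
by apply: Ck_inv => //; [exact: q_neq0 | apply: Cq; exact: Ck_id].
Qed.

Lemma hasD_q X Y z v : differentiable X z -> differentiable Y z ->
  hasD (fun x => q (X x) (Y x)) z v (q ('D_v X z) (Y z) + q (X z) ('D_v Y z)).
Proof.
move=> dX dY.
have dco i Z : differentiable Z z ->
    hasD (fun x => co i (Z x)) z v (co i ('D_v Z z)).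
  by move=> dZ; split; [apply: differentiable_postlin | apply: D_postlin] => //;
    exact: co_continuous.
have dm i := hasD_mul (dco i X dX) (dco i Y dY).
split.
  have -> : (fun x => q (X x) (Y x)) = \sum_i (fun x => co i (X x) * co i (Y x)).
    by apply/funext => x; rewrite fct_sumE.
  by elim/big_ind : _ => [|g h|i _];
    [exact: (differentiable_cst (0 : R)) | exact: differentiableD | have [] := dm i].
apply: (etrans (@D_sum _ _ _ _ (fun i x => co i (X x) * co i (Y x)) v z _)).
  by move=> i; have [] := dm i.
rewrite /q -big_split/=; apply: eq_bigr => i _.
by have [_ ->] := dm i; rewrite addrC.
Qed.

(** The last term is the derivative of the factor 1 / |z|^2. *)
Lemma hasD_br X Y z v : vf X -> vf Y -> P z ->
  hasD (fun x => br x (X x) (Y x)) z v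
    (br z ('D_v X z) (Y z) + br z (X z) ('D_v Y z)
     - 2 * br z v z * br z (X z) (Y z)).
Proof.
move=> vX vY Pz.
have dq := hasD_q v (vf_diff vX Pz) (vf_diff vY Pz).
have didD := hasD_q v (vf_diff vf_id Pz) (vf_diff vf_id Pz).
have := hasD_mul dq (@hasD_inv _ _ (fun x => q x x) _ _ _ (q_neq0 Pz) didD).
rewrite (derive_id z v) => H.
congr (hasD _ _ _ _) : H; rewrite /br (qC z v).
by ring.
Qed.

End InvariantFields.

(** * Pointwise algebra of the metric and of the tensor Gam *)

Section PointwiseAlgebra.
Variables (R : realType) (n : nat).
Local Notation V := (Cn R n).
Variables (z : V) (alpha beta k : R).
Hypotheses (Pz : punctured z) (betaE : beta = k * alpha).
Implicit Types (v w u x y : V) (c : R).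

Lemma brC v w : br z v w = br z w v.
Proof. by rewrite /br qC. Qed.
Lemma brDl u v w : br z (u + v) w = br z u w + br z v w.
Proof. by rewrite /br qDl mulrDl. Qed.
Lemma brZl c v w : br z (c *: v) w = c * br z v w.
Proof. by rewrite /br qZl mulrA. Qed.
Lemma brNl v w : br z (- v) w = - br z v w.
Proof. by rewrite /br qNl mulNr. Qed.
Lemma brDr u v w : br z w (u + v) = br z w u + br z w v.
Proof. by rewrite /br qDr mulrDl. Qed.
Lemma brZr c v w : br z w (c *: v) = c * br z w v.
Proof. by rewrite /br qZr mulrA. Qed.
Lemma brNr v w : br z w (- v) = - br z w v.
Proof. by rewrite /br qNr mulNr. Qed.
Lemma brJl v w : br z (Jst v) w = - br z v (Jst w).
Proof. by rewrite /br qJl mulNr. Qed.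
Lemma brJr v w : br z v (Jst w) = - br z w (Jst v).
Proof. by rewrite brC brJl. Qed.
Lemma br_zz : br z z z = 1.
Proof. by rewrite /br divff// q_neq0. Qed.
Lemma br_zJ v : br z v (Jst v) = 0.
Proof. have := brJr v v; lra. Qed.
Lemma br_ge0 v : 0 <= br z v v.
Proof. by rewrite divr_ge0// q_ge0. Qed.

Definition brE := (brDl, brDr, brZl, brZr, brNl, brNr, brJl, JD, JN, JZ, JJ).

Local Notation l v := (br z v z).
Local Notation m v := (br z v (Jst z)).
Local Notation g := (hopf_metric alpha beta z).

Lemma metricE v w : g v w = 2 * (alpha * br z v w + beta * (l v * l w + m v * m w)).
Proof. exact: hopf_metricE. Qed.

Lemma metricC v w : g v w = g w v.
Proof. by rewrite !metricE [br z v w]brC; ring. Qed.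
Lemma metricDl u v w : g (u + v) w = g u w + g v w.
Proof. by rewrite !metricE !brE; ring. Qed.
Lemma metricZl c v w : g (c *: v) w = c * g v w.
Proof. by rewrite !metricE !brE; ring. Qed.
Lemma metricNl v w : g (- v) w = - g v w.
Proof. by rewrite !metricE !brE; ring. Qed.
Lemma metricDr u v w : g w (u + v) = g w u + g w v.
Proof. by rewrite metricC metricDl ![g _ w]metricC. Qed.
Lemma metricZr c v w : g w (c *: v) = c * g w v.
Proof. by rewrite metricC metricZl metricC. Qed.
Lemma metricNr v w : g w (- v) = - g w v.
Proof. by rewrite metricC metricNl metricC. Qed.
Lemma metricJ v w : g (Jst v) (Jst w) = g v w.
Proof. by rewrite !metricE !brE; ring. Qed.
Lemma metricJl v w : g (Jst v) w = - g v (Jst w).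
Proof. by rewrite -metricJ JJ metricNl. Qed.

Definition gE := (metricDl, metricDr, metricNl, metricNr, metricZl, metricZr).

(** The sum of squares l^2 + m^2 is at most [br z v v] since v - l z - m Jz has
    a nonnegative square; hence g is at least 2 min(alpha, alpha + beta)
    times the rescaled flat metric. *)
Lemma metric_definite v : 0 < alpha -> - alpha < beta -> g v v = 0 -> v = 0.
Proof.
move=> a0 ab gv.
have CS : 0 <= br z v v - l v ^+ 2 - m v ^+ 2.
  have -> : br z v v - l v ^+ 2 - m v ^+ 2 =
      br z (v - l v *: z - m v *: Jst z) (v - l v *: z - m v *: Jst z).
    rewrite !brE (brC z v) (br_zJ z) br_zz.
    by rewrite -[br z z (Jst v)]opprK -brJr; ring.
  exact: br_ge0.
have b0 := br_ge0 v.
have l0 := sqr_ge0 (l v); have m0 := sqr_ge0 (m v).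
have bv : br z v v = 0.
  apply/eqP; rewrite eq_le b0 andbT.
  move: gv; rewrite metricE -!expr2 => gv.
  have [bp|bn] := leP 0 beta; nra.
apply: q_eq0; move/eqP: bv; rewrite /br mulf_eq0 invr_eq0.
by rewrite (negPf (q_neq0 Pz)) orbF => /eqP.
Qed.

(** With [lam v] = l v + i m v the complex linear form (v, z) / |z|^2, this is
    2 (- lam(y) x + k lam(x) y - k lam(x) lam(y) z), complex bilinear in x, y. *)
Definition Gam x y : V := 2 *: (- (l y *: x + m y *: Jst x)
  + k *: (l x *: y + m x *: Jst y)
  - k *: ((l x * l y - m x * m y) *: z + (l x * m y + m x * l y) *: Jst z)).

(** The derivatives of l and m at a fixed vector x in the direction v. *)
Definition dl v x := br z x v - 2 * l v * l x.
Definition dm v x := br z x (Jst v) - 2 * l v * m x.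

(** The derivative of g at fixed vectors x and w in the direction v. *)
Definition dmetric v x w := 2 * (alpha * (- 2 * l v * br z x w)
  + beta * (dl v x * l w + l x * dl v w + dm v x * m w + m x * dm v w)).

(** The derivative of Gam at fixed vectors y and w in the direction v. *)
Definition dGam v y w : V := 2 *: (- (dl v w *: y + dm v w *: Jst y)
  + k *: (dl v y *: w + dm v y *: Jst w)
  - k *: ((dl v y * l w + l y * dl v w - dm v y * m w - m y * dm v w) *: z
          + (l y * l w - m y * m w) *: v
          + (dl v y * m w + l y * dm v w + dm v y * l w + m y * dl v w) *: Jst z
          + (l y * m w + m y * l w) *: Jst v)).

(** The tensor Gam is found by solving this identity for it: the right-hand side
    is the part of (L_Y g)(X, Z) - (L_(JY) g)(JX, Z) that contains no
    derivative of X, Y or Z. *)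
Lemma metric_Gam x y w :
  g (Gam x y) w = dmetric y x w - dmetric (Jst y) (Jst x) w.
Proof.
rewrite metricE /Gam /dmetric /dl /dm betaE !brE.
rewrite (brC z w) (brC y w) (br_zJ z) br_zz.
rewrite (brJr z w) (brJr y w).
by ring.
Qed.

(** Together with the next lemma: lam(Gam(x, y)) = -2 lam(x) lam(y). *)
Lemma l_Gam x y : l (Gam x y) = - 2 * (l x * l y - m x * m y).
Proof. by rewrite /Gam !brE (br_zJ z) br_zz; ring. Qed.

Lemma m_Gam x y : m (Gam x y) = - 2 * (l x * m y + m x * l y).
Proof. by rewrite /Gam !brE (br_zJ z) br_zz; ring. Qed.

(* The proofs of the vector identities below abstract all scalars and all
   vectors x, Jx, y, Jy and so on, and then compare coordinates. *)
Lemma Gam_Jl x y : Gam (Jst x) y = Jst (Gam x y).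
Proof.
rewrite /Gam !brE.
move: (l x) (l y) (m x) (m y) (Jst x) (Jst y) (Jst z) => lx ly mx my jx jy jz.
apply: co_inj => i; rewrite !coE.
move: (co i x) (co i y) (co i z) (co i jx) (co i jy) (co i jz) => *; ring.
Qed.

Lemma Gam_Jr x y : Gam x (Jst y) = Jst (Gam x y).
Proof.
rewrite /Gam !brE.
move: (l x) (l y) (m x) (m y) (Jst x) (Jst y) (Jst z) => lx ly mx my jx jy jz.
apply: co_inj => i; rewrite !coE.
move: (co i x) (co i y) (co i z) (co i jx) (co i jy) (co i jz) => *; ring.
Qed.

Lemma Gam_Dl x x' y : Gam (x + x') y = Gam x y + Gam x' y.
Proof.
rewrite /Gam !brE.
move: (l x) (l x') (l y) (m x) (m x') (m y) (Jst x) (Jst x') (Jst y) (Jst z)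
  => lx lx' ly mx mx' my jx jx' jy jz.
apply: co_inj => i; rewrite !coE.
move: (co i x) (co i x') (co i y) (co i z) (co i jx) (co i jx') (co i jy)
  (co i jz) => *; ring.
Qed.

Lemma Gam_Dr x y y' : Gam x (y + y') = Gam x y + Gam x y'.
Proof.
rewrite /Gam !brE.
move: (l x) (l y') (l y) (m x) (m y') (m y) (Jst x) (Jst y') (Jst y) (Jst z)
  => lx ly' ly mx my' my jx jy' jy jz.
apply: co_inj => i; rewrite !coE.
move: (co i x) (co i y') (co i y) (co i z) (co i jx) (co i jy') (co i jy)
  (co i jz) => *; ring.
Qed.

Lemma Gam_Nl x y : Gam (- x) y = - Gam x y.
Proof.
rewrite /Gam !brE.
move: (l x) (l y) (m x) (m y) (Jst x) (Jst y) (Jst z) => lx ly mx my jx jy jz.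
apply: co_inj => i; rewrite !coE.
move: (co i x) (co i y) (co i z) (co i jx) (co i jy) (co i jz) => *; ring.
Qed.

Lemma Gam_Nr x y : Gam x (- y) = - Gam x y.
Proof.
rewrite /Gam !brE.
move: (l x) (l y) (m x) (m y) (Jst x) (Jst y) (Jst z) => lx ly mx my jx jy jz.
apply: co_inj => i; rewrite !coE.
move: (co i x) (co i y) (co i z) (co i jx) (co i jy) (co i jz) => *; ring.
Qed.

(** The real and imaginary parts of lam(x) lam(y) and of
    lam(x) lam(y) lam(w). *)
Definition re2 x y := l x * l y - m x * m y.
Definition im2 x y := l x * m y + m x * l y.
Definition re3 x y w := l x * re2 y w - m x * im2 y w.
Definition im3 x y w := l x * im2 y w + m x * re2 y w.

(** The (1,0) derivative of lam(w) along x is -2 lam(x) lam(w) and that of the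
    position z is 2 x, so that of Gam is again complex trilinear. *)
Lemma dGam10 x y w : dGam x y w - Jst (dGam (Jst x) y w) =
  4 *: (re2 x w *: y + im2 x w *: Jst y - k *: (re2 x y *: w + im2 x y *: Jst w)
    - k *: (re2 y w *: x + im2 y w *: Jst x)
    + (2 * k) *: (re3 x y w *: z + im3 x y w *: Jst z)).
Proof.
rewrite /re3 /im3 /re2 /im2 /dGam /dl /dm !brE.
move: (l x) (l y) (l w) (m x) (m y) (m w) => lx ly lw mx my mw.
move: (br z w x) (br z w (Jst x)) (br z y x) (br z y (Jst x)) => b1 b2 b3 b4.
move: (Jst x) (Jst y) (Jst w) (Jst z) => jx jy jw jz.
apply: co_inj => i; rewrite !coE.
move: (co i x) (co i y) (co i w) (co i z) (co i jx) (co i jy) (co i jw)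
  (co i jz) => *; ring.
Qed.

Lemma GamGam x y w : Gam x (Gam y w) =
  4 *: (re2 y w *: x + im2 y w *: Jst x
    + k *: (k *: (re2 x y *: w + im2 x y *: Jst w)
            - (re2 x w *: y + im2 x w *: Jst y)
            + (1 - k) *: (re3 x y w *: z + im3 x y w *: Jst z))).
Proof.
rewrite {1}/Gam l_Gam m_Gam /re3 /im3 /re2 /im2 /Gam !brE.
move: (l x) (l y) (l w) (m x) (m y) (m w) => lx ly lw mx my mw.
move: (Jst x) (Jst y) (Jst w) (Jst z) => jx jy jw jz.
apply: co_inj => i; rewrite !coE.
move: (co i x) (co i y) (co i w) (co i z) (co i jx) (co i jy) (co i jw)
  (co i jz) => *; ring.
Qed.

(** The Maurer-Cartan equation for Gam: D10 + Gam is flat in the (1,0)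
    directions. By [dGam10] and [GamGam] the sum is symmetric in x and y. *)
Lemma Gam_flat x y w :
  dGam x y w - Jst (dGam (Jst x) y w) + Gam x (Gam y w) =
  dGam y x w - Jst (dGam (Jst y) x w) + Gam y (Gam x w).
Proof.
rewrite !dGam10 !GamGam /re3 /im3 /re2 /im2.
move: (l x) (l y) (l w) (m x) (m y) (m w) => lx ly lw mx my mw.
move: (Jst x) (Jst y) (Jst w) (Jst z) => jx jy jw jz.
apply: co_inj => i; rewrite !coE.
move: (co i x) (co i y) (co i w) (co i z) (co i jx) (co i jy) (co i jw)
  (co i jz) => *; ring.
Qed.

End PointwiseAlgebra.

(** * Derivatives of the metric and of Gam along vector fields *)

Section FieldDerivatives.
Variables (R : realType) (n : nat) (a : 'rV[R[i]]_n) (rho : R).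
Local Notation V := (Cn R n).
Local Notation vf := (is_vfield a).
Local Notation fn := (is_function a).
Local Notation P := (@punctured R n).
Implicit Types (X Y Z : V -> V) (z v w : V).

Hypothesis a_rho :
  forall j, complex.Re (a 0 j) ^+ 2 + complex.Im (a 0 j) ^+ 2 = rho.
Hypothesis rho0 : rho != 0.

Variables (alpha beta k : R).

Local Notation vJ := (@vf_J R n a).
Local Notation g := (hopf_metric alpha beta).

Lemma D_J X z v : vf X -> P z -> 'D_v (fun x => Jst (X x)) z = Jst ('D_v X z).
Proof.
move=> vX Pz; have cJ := @lin_continuous R n _ (@Jst R n).
exact: (D_postlin v cJ (vf_diff vX Pz)).
Qed.

Lemma hasD_vf X z v : vf X -> P z -> hasD X z v ('D_v X z).
Proof. by move=> vX Pz; split=> //; exact: vf_diff vX Pz. Qed.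

Lemma hasD_id z v : hasD (fun x : V => x) z v v.
Proof. by split; [have H := is_diff_id z; exact: ex_diff | exact: derive_id]. Qed.

Lemma hasD_J X z v d : vf X -> P z -> hasD X z v d ->
  hasD (fun x => Jst (X x)) z v (Jst d).
Proof.
move=> vX Pz [_ <-]; split; last exact: D_J.
exact: vf_diff (vJ vX) Pz.
Qed.

Lemma hasD_l X z v : vf X -> P z ->
  hasD (fun x => br x (X x) x) z v (br z ('D_v X z) z + dl z v (X z)).
Proof.
move=> vX Pz; have := hasD_br v vX (@vf_id R n a) Pz.
by rewrite (derive_id z v) /dl addrA.
Qed.

Lemma hasD_m X z v : vf X -> P z ->
  hasD (fun x => br x (X x) (Jst x)) z v
    (br z ('D_v X z) (Jst z) + dm z v (X z)).
Proof.
move=> vX Pz; have := hasD_br v vX (vJ (@vf_id R n a)) Pz.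
by rewrite (D_J v (@vf_id R n a) Pz) (derive_id z v) /dm addrA.
Qed.

Lemma hasD_metric X Y z v : vf X -> vf Y -> P z ->
  hasD (fun x => g x (X x) (Y x)) z v
    (g z ('D_v X z) (Y z) + g z (X z) ('D_v Y z)
     + dmetric z alpha beta v (X z) (Y z)).
Proof.
move=> vX vY Pz.
have := hasD_mulc 2 (hasD_add (hasD_mulc alpha (hasD_br v vX vY Pz))
  (hasD_mulc beta (hasD_add (hasD_mul (hasD_l v vX Pz) (hasD_l v vY Pz))
                            (hasD_mul (hasD_m v vX Pz) (hasD_m v vY Pz))))).
have -> : (fun x => g x (X x) (Y x)) = (fun x => 2 *
    (alpha * br x (X x) (Y x) + beta * (br x (X x) x * br x (Y x) x
      + br x (X x) (Jst x) * br x (Y x) (Jst x)))).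
  by apply/funext => x; rewrite metricE.
move=> H; apply: (hasD_eq H).
rewrite !metricE /dmetric.
move: ('D_v X z) ('D_v Y z) (dl z v (X z)) (dl z v (Y z)) (dm z v (X z))
  (dm z v (Y z)) => dX dY a1 a2 a3 a4.
move: (br z dX (Y z)) (br z (X z) dY) (br z v z) (br z (X z) (Y z))
  (br z dX z) (br z dY z) (br z (X z) z) (br z (Y z) z)
  (br z dX (Jst z)) (br z dY (Jst z)) (br z (X z) (Jst z)) (br z (Y z) (Jst z)).
by move=> *; ring.
Qed.

Lemma fn_metric X Y : vf X -> vf Y -> fn (fun z => g z (X z) (Y z)).
Proof.
move=> vX vY.
have -> : (fun x => g x (X x) (Y x)) = (fun x => 2 *
    (alpha * br x (X x) (Y x) + beta * (br x (X x) x * br x (Y x) x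
      + br x (X x) (Jst x) * br x (Y x) (Jst x)))).
  by apply/funext => x; rewrite metricE.
have fb X' Y' : vf X' -> vf Y' -> fn (fun z => br z (X' z) (Y' z)).
  by move=> vX' vY'; exact: (fn_br a_rho rho0 vX' vY').
have vE := @vf_id R n a; have vJE := vJ vE.
apply: fn_mul; first exact: fn_cst.
apply: fn_add; apply: fn_mul; do ?exact: fn_cst; first exact: fb.
by apply: fn_add; apply: fn_mul; exact: fb.
Qed.

Lemma vf_Gam X Y : vf X -> vf Y -> vf (fun z => Gam z k (X z) (Y z)).
Proof.
move=> vX vY; rewrite /Gam.
have fb X' Y' : vf X' -> vf Y' -> fn (fun z => br z (X' z) (Y' z)).
  by move=> vX' vY'; exact: (fn_br a_rho rho0 vX' vY').
have vE := @vf_id R n a; have vJE := vJ vE.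
have vJX := vJ vX; have vJY := vJ vY.
have [lX lY] := (fb _ _ vX vE, fb _ _ vY vE).
have [mX mY] := (fb _ _ vX vJE, fb _ _ vY vJE).
have fN f : fn f -> fn (fun z => - f z).
  move=> ff; have := fn_mul (fn_cst a (-1)) ff.
  by congr (is_function _ _); apply/funext => x; rewrite mulN1r.
apply: vf_scale; first exact: fn_cst.
apply: vf_sub; [apply: vf_add; [apply: vf_opp|]|].
- by apply: vf_add; apply: vf_scale.
- apply: vf_scale; first exact: fn_cst.
  by apply: vf_add; apply: vf_scale.
- apply: vf_scale; first exact: fn_cst.
  apply: vf_add; apply: vf_scale => //; apply: fn_add; do ?apply: fN;
    by apply: fn_mul.
Qed.

Lemma hasD_Gam X Y z v : vf X -> vf Y -> P z ->
  hasD (fun x => Gam x k (X x) (Y x)) z v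
    (Gam z k ('D_v X z) (Y z) + Gam z k (X z) ('D_v Y z)
     + dGam z k v (X z) (Y z)).
Proof.
move=> vX vY Pz; rewrite [in X in hasD X]/Gam.
have [hX hY] := (hasD_vf v vX Pz, hasD_vf v vY Pz).
have [hJX hJY] := (hasD_J vX Pz hX, hasD_J vY Pz hY).
have hE := hasD_id z v; have hJE := hasD_J (@vf_id R n a) Pz hE.
have [lX lY] := (hasD_l v vX Pz, hasD_l v vY Pz).
have [mX mY] := (hasD_m v vX Pz, hasD_m v vY Pz).
have H := hasD_scale (hasD_cst (2 : R) z v) (hasD_add (hasD_add
  (hasD_opp (hasD_add (hasD_scale lY hX) (hasD_scale mY hJX)))
  (hasD_scale (hasD_cst k z v)
     (hasD_add (hasD_scale lX hY) (hasD_scale mX hJY))))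
  (hasD_opp (hasD_scale (hasD_cst k z v) (hasD_add
     (hasD_scale (hasD_add (hasD_mul lX lY) (hasD_opp (hasD_mul mX mY))) hE)
     (hasD_scale (hasD_add (hasD_mul lX mY) (hasD_mul mX lY)) hJE))))).
apply: (hasD_eq H) => {H lX lY mX mY hX hY hJX hJY hE hJE}.
rewrite /Gam /dGam.
move: ('D_v X z) ('D_v Y z) (dl z v (X z)) (dl z v (Y z)) (dm z v (X z))
  (dm z v (Y z)) => dX dY a1 a2 a3 a4.
move: (X z) (Y z) => x y.
move: (br z dX z) (br z dY z) (br z x z) (br z y z)
  (br z dX (Jst z)) (br z dY (Jst z)) (br z x (Jst z)) (br z y (Jst z)).
move: (Jst x) (Jst y) (Jst z) (Jst dX) (Jst dY) (Jst v) => jx jy jz jdX jdY jv.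
move=> *; apply: co_inj => i; rewrite !coE.
move: (co i x) (co i y) (co i z) (co i v) (co i dX) (co i dY) (co i jx)
  (co i jy) (co i jz) (co i jv) (co i jdX) (co i jdY) => *; ring.
Qed.

End FieldDerivatives.

(** * The Bismut connection in the (1,0) directions *)

Section Bismut.
Variables (R : realType) (n : nat) (a : 'rV[R[i]]_n) (rho : R).
Local Notation V := (Cn R n).
Local Notation vf := (is_vfield a).
Local Notation fn := (is_function a).
Local Notation P := (@punctured R n).
Implicit Types (X Y Z W : V -> V) (z v w : V) (f : V -> R).

Hypothesis a_rho :
  forall j, complex.Re (a 0 j) ^+ 2 + complex.Im (a 0 j) ^+ 2 = rho.
Hypothesis rho0 : rho != 0.

Variables (alpha beta k : R).
Hypotheses (alpha0 : 0 < alpha) (betaN : - alpha < beta)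
  (betaE : beta = k * alpha).

Local Notation g := (hopf_metric alpha beta).
Local Notation J X := (fun x => Jst (X x)).
Let vJ X : vf X -> vf (J X) := @vf_J R n a X.
Let oP : open P := @open_punctured R n.

Variable nabla : (V -> V) -> (V -> V) -> (V -> V).
Hypothesis nabla_conn : is_connection a nabla.
Hypothesis nabla_g : metric_parallel a g nabla.
Hypothesis nabla_J : J_parallel a nabla.
Hypothesis nabla_skew : skew_torsion a g nabla.

Lemma n_vf X Y : vf X -> vf Y -> vf (nabla X Y).
Proof. exact: conn_vfield. Qed.

Lemma n_extl X X' Y z : vf X -> vf X' -> vf Y -> P z ->
  (forall x, P x -> X x = X' x) -> nabla X Y z = nabla X' Y z.
Proof. by move=> vX vX' vY Pz XX'; apply: (conn_ext nabla_conn). Qed.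

Lemma n_extr X Y Y' z : vf X -> vf Y -> vf Y' -> P z ->
  (forall x, P x -> Y x = Y' x) -> nabla X Y z = nabla X Y' z.
Proof. by move=> vX vY vY' Pz YY'; apply: (conn_ext nabla_conn). Qed.

Lemma nDl X X' Y z : vf X -> vf X' -> vf Y -> P z ->
  nabla (fun x => X x + X' x) Y z = nabla X Y z + nabla X' Y z.
Proof.
move=> vX vX' vY Pz.
have := conn_linear nabla_conn (fn_cst a 1) vX vX' vY Pz.
rewrite scale1r => <-; congr (nabla _ _ _).
by apply/funext => x; rewrite scale1r.
Qed.

Lemma n0l Y z : vf Y -> P z -> nabla (fun=> 0) Y z = 0.
Proof.
move=> vY Pz.
have v0 : vf (fun=> 0).
  have := vf_sub (vf_id a) (vf_id a).
  by congr (is_vfield _ _); apply/funext => x; rewrite subrr.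
have := nDl v0 v0 vY Pz.
have -> : (fun x : V => 0 + 0) = (fun=> 0 : V) by apply/funext => x; rewrite addr0.
by move=> /eqP; rewrite -subr_eq0 opprD addrA subrr sub0r oppr_eq0 => /eqP.
Qed.

Lemma nZl f X Y z : fn f -> vf X -> vf Y -> P z ->
  nabla (fun x => f x *: X x) Y z = f z *: nabla X Y z.
Proof.
move=> ff vX vY Pz.
have v0 : vf (fun=> 0).
  have := vf_sub (vf_id a) (vf_id a).
  by congr (is_vfield _ _); apply/funext => x; rewrite subrr.
have := conn_linear nabla_conn ff vX v0 vY Pz; rewrite n0l// addr0 => <-.
by congr (nabla _ _ _); apply/funext => x; rewrite addr0.
Qed.

Lemma nNl X Y z : vf X -> vf Y -> P z ->
  nabla (fun x => - X x) Y z = - nabla X Y z.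
Proof.
move=> vX vY Pz; rewrite -scaleN1r -(nZl (fn_cst a (-1)) vX vY Pz).
by congr (nabla _ _ _); apply/funext => x; rewrite scaleN1r.
Qed.

Lemma nDr X Y Y' z : vf X -> vf Y -> vf Y' -> P z ->
  nabla X (fun x => Y x + Y' x) z = nabla X Y z + nabla X Y' z.
Proof. by move=> vX vY vY' Pz; exact: (conn_additive nabla_conn). Qed.

Lemma nZr f X Y z : fn f -> vf X -> vf Y -> P z ->
  nabla X (fun x => f x *: Y x) z = 'D_(X z) f z *: Y z + f z *: nabla X Y z.
Proof. by move=> ff vX vY Pz; exact: (conn_leibniz nabla_conn). Qed.

Lemma nNr X Y z : vf X -> vf Y -> P z ->
  nabla X (fun x => - Y x) z = - nabla X Y z.
Proof.
move=> vX vY Pz; have := nZr (fn_cst a (-1)) vX vY Pz.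
rewrite (derive_cst (-1 : R) z (X z)) scale0r add0r scaleN1r => <-.
by congr (nabla _ _ _); apply/funext => x; rewrite scaleN1r.
Qed.

Lemma nJ X Y z : vf X -> vf Y -> P z -> nabla X (J Y) z = Jst (nabla X Y z).
Proof. by move=> vX vY Pz; exact: nabla_J. Qed.

(** Skewness of the torsion leaves the symmetric part of the endomorphism
    X |-> nabla_X Y equal to half the Lie derivative of g along Y. *)
Lemma symmetric_part X Y Z z : vf X -> vf Y -> vf Z -> P z ->
  g z (nabla X Y z) (Z z) + g z (nabla Z Y z) (X z) =
  g z ('D_(X z) Y z) (Z z) + g z (X z) ('D_(Z z) Y z)
  + dmetric z alpha beta (Y z) (X z) (Z z).
Proof.
move=> vX vY vZ Pz.
have M := etrans (esym (hasD_metric alpha beta (Y z) vX vZ Pz).2)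
                 (nabla_g vY vX vZ Pz).
have [_ T] := nabla_skew vY vX vZ Pz.
move: M T; rewrite /torsion /bracket.
move: (nabla Y X z) (nabla X Y z) (nabla Y Z z) (nabla Z Y z)
  ('D_(Y z) X z) ('D_(X z) Y z) ('D_(Y z) Z z) ('D_(Z z) Y z)
  (dmetric _ _ _ _ _ _) => nYX nXY nYZ nZY dYX dXY dYZ dZY dm.
move: (X z) (Z z) => x w; rewrite !gE.
rewrite (metricC z alpha beta x nYZ) (metricC z alpha beta x dYZ)
  (metricC z alpha beta x dZY).
lra.
Qed.

(** Twice the derivative of Y along the (1,0) part of X, with J in the role of i
    on the values. *)
Definition nabla10 X Y : V -> V :=
  fun z => nabla X Y z - Jst (nabla (J X) Y z).

Definition D10 X Y : V -> V :=
  fun z => 'D_(X z) Y z - Jst ('D_(Jst (X z)) Y z).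

Lemma vf_nabla10 X Y : vf X -> vf Y -> vf (nabla10 X Y).
Proof.
by move=> vX vY; apply: vf_sub; [|apply: vJ]; apply: n_vf => //; exact: vJ.
Qed.

Lemma vf_D10 X Y : vf X -> vf Y -> vf (D10 X Y).
Proof.
move=> vX vY; apply: vf_sub; first exact: vf_D a_rho rho0 _ _ vX vY.
by apply: vJ; apply: (vf_D a_rho rho0 (vJ vX) vY).
Qed.

(** The difference of [symmetric_part] for X, Y and for JX, JY: the terms
    g(nabla_Z Y, X) and g(nabla_Z JY, JX) are equal and cancel. *)
Lemma metric_nabla10 X Y Z z : vf X -> vf Y -> vf Z -> P z ->
  g z (nabla10 X Y z) (Z z) = g z (D10 X Y z + Gam z k (X z) (Y z)) (Z z).
Proof.
move=> vX vY vZ Pz; rewrite metricDl (metric_Gam Pz betaE).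
have := symmetric_part (vJ vX) (vJ vY) vZ Pz.
rewrite (nJ (vJ vX) vY Pz) (nJ vZ vY Pz) (D_J _ vY Pz) (D_J _ vY Pz).
have := symmetric_part vX vY vZ Pz; rewrite /nabla10 /D10.
move: (nabla X Y z) (nabla Z Y z) (nabla (J X) Y z) ('D_(X z) Y z)
  ('D_(Z z) Y z) ('D_(Jst (X z)) Y z) => nXY nZY nJXY dXY dZY dJXY.
move: (dmetric _ _ _ _ _ _) (dmetric _ _ _ _ _ _) => d1 d2.
rewrite !gE !metricJ; lra.
Qed.

(** The metric determines [nabla10 X Y], since the difference of the two sides
    is itself an admissible test field. *)
Lemma nabla10E X Y z : vf X -> vf Y -> P z ->
  nabla10 X Y z = D10 X Y z + Gam z k (X z) (Y z).
Proof.
move=> vX vY Pz.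
pose F x := nabla10 X Y x - (D10 X Y x + Gam x k (X x) (Y x)).
have vF : vf F.
  apply: vf_sub; first exact: vf_nabla10.
  by apply: vf_add; [exact: vf_D10 | exact: vf_Gam a_rho rho0 _ _ _ vX vY].
apply/eqP; rewrite -subr_eq0; apply/eqP; rewrite -/(F z).
apply: (metric_definite Pz alpha0 betaN).
by rewrite {1}/F metricDl metricNl (metric_nabla10 vX vY vF Pz) subrr.
Qed.

Lemma nabla10_nabla10 X Y Z z : vf X -> vf Y -> vf Z -> P z ->
  nabla10 X (nabla10 Y Z) z =
  nabla X (nabla Y Z) z - Jst (nabla (J X) (nabla Y Z) z)
  - Jst (nabla X (nabla (J Y) Z) z) - nabla (J X) (nabla (J Y) Z) z.
Proof.
move=> vX vY vZ Pz; rewrite {1}/nabla10.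
have vYZ := n_vf vY vZ; have vJYZ := n_vf (vJ vY) vZ.
have E U : vf U -> nabla U (nabla10 Y Z) z =
    nabla U (nabla Y Z) z - Jst (nabla U (nabla (J Y) Z) z).
  move=> vU; apply: (etrans (nDr vU vYZ (vf_opp (vJ vJYZ)) Pz)).
  congr (_ + _); apply: (etrans (nNr vU (vJ vJYZ) Pz)).
  by congr (- _); exact: nJ.
rewrite !E//; last exact: vJ.
rewrite !(JD, JN, JJ).
move: (nabla X (nabla Y Z) z) (Jst (nabla (J X) (nabla Y Z) z))
  (Jst (nabla X (nabla (J Y) Z) z)) (nabla (J X) (nabla (J Y) Z) z).
by move=> *; apply: co_inj => i; rewrite !coE; ring.
Qed.

(** The vanishing of the Nijenhuis tensor of J. *)
Lemma bracket_J X Y z : vf X -> vf Y -> P z ->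
  Jst (bracket X Y z - bracket (J X) (J Y) z) =
  bracket (J X) Y z + bracket X (J Y) z.
Proof.
move=> vX vY Pz; rewrite /bracket !(D_J _ vX Pz) !(D_J _ vY Pz).
move: ('D_(X z) Y z) ('D_(Y z) X z) ('D_(Jst (X z)) Y z) ('D_(Jst (Y z)) X z).
move=> xy yx jxy jyx; rewrite !(JD, JN, JJ).
move: (Jst xy) (Jst yx) => jx jy; apply: co_inj => i; rewrite !coE; ring.
Qed.

Lemma D_D10 X Y v z : vf X -> vf Y -> P z ->
  'D_v (D10 X Y) z = 'D_v (fun x => 'D_(X x) Y x) z
    - Jst ('D_v (fun x => 'D_(Jst (X x)) Y x) z).
Proof.
move=> vX vY Pz.
have v1 := vf_D a_rho rho0 vX vY; have v2 := vf_D a_rho rho0 (vJ vX) vY.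
apply: (etrans (D_sub v (vf_diff v1 Pz) (vf_diff (vJ v2) Pz))).
by congr (_ - _); exact: (D_J v v2 Pz).
Qed.

Lemma nabla10_nabla10E X Y Z z : vf X -> vf Y -> vf Z -> P z ->
  nabla10 X (nabla10 Y Z) z =
  ('D_(X z) (fun x => 'D_(Y x) Z x) z
     - Jst ('D_(X z) (fun x => 'D_(Jst (Y x)) Z x) z)
   - Jst ('D_(Jst (X z)) (fun x => 'D_(Y x) Z x) z)
     - 'D_(Jst (X z)) (fun x => 'D_(Jst (Y x)) Z x) z)
  + (Gam z k (D10 X Y z) (Z z) + Gam z k (Y z) (D10 X Z z)
     + Gam z k (X z) (D10 Y Z z))
  + (dGam z k (X z) (Y z) (Z z) - Jst (dGam z k (Jst (X z)) (Y z) (Z z))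
     + Gam z k (X z) (Gam z k (Y z) (Z z))).
Proof.
move=> vX vY vZ Pz.
have vYZ := vf_nabla10 vY vZ.
rewrite (nabla10E vX vYZ Pz) (nabla10E vY vZ Pz) (Gam_Dr z k).
have vD := vf_D10 vY vZ; have vG := vf_Gam a_rho rho0 k vY vZ.
have E v : 'D_v (nabla10 Y Z) z =
    'D_v (fun x => 'D_(Y x) Z x) z - Jst ('D_v (fun x => 'D_(Jst (Y x)) Z x) z)
    + (Gam z k ('D_v Y z) (Z z) + Gam z k (Y z) ('D_v Z z)
       + dGam z k v (Y z) (Z z)).
  apply: (etrans (D_open v oP (fun x Px => nabla10E vY vZ Px) Pz)).
  apply: (etrans (D_add v (vf_diff vD Pz) (vf_diff vG Pz))).
  by congr (_ + _); [exact: D_D10 | exact: (hasD_Gam k v vY vZ Pz).2].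
rewrite {1}/D10 (E (X z)) (E (Jst (X z))) {E}.
rewrite [D10 X Y z]/D10 [D10 X Z z]/D10.
rewrite !(Gam_Dl, Gam_Dr, Gam_Nl, Gam_Nr, Gam_Jl, Gam_Jr) !(JD, JN, JJ).
have alg (a1 a2 a3 a4 b1 b2 b3 b4 b5 b6 b7 c1 c2 : V) :
    a1 - a2 + (b3 + b4 + b7) - (a3 - - a4 + (b5 + b6 + b1)) + (c1 - c2 + b2)
    = a1 - a2 - a3 - a4 + (b3 - b5 + (b4 - b6) + (c1 - c2)) + (b7 - b1 + b2).
  by apply: co_inj => i; rewrite !coE; ring.
exact: alg.
Qed.

(** The operators [nabla10 X] form a flat connection along the (1,0)
    directions: by [nabla10E] they are D10 + Gam, to which [Gam_flat] applies,
    and D10 itself has no curvature by [D_bracket]. *)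
Lemma curvature10_eq0 X Y Z z : vf X -> vf Y -> vf Z -> P z ->
  curvature nabla X Y Z z - Jst (curvature nabla (J X) Y Z z)
  - Jst (curvature nabla X (J Y) Z z) - curvature nabla (J X) (J Y) Z z = 0.
Proof.
move=> vX vY vZ Pz.
have [vJX vJY] := (vJ vX, vJ vY).
have vbr U W : vf U -> vf W -> vf (bracket U W).
  by move=> vU vW; exact: (vf_bracket a_rho rho0 vU vW).
pose B x := bracket X Y x - bracket (J X) (J Y) x.
have vB : vf B by apply: vf_sub; exact: vbr.
(* by the vanishing of the Nijenhuis tensor, the bracket terms combine to a
   single nabla10 B *)
have NB : nabla10 B Z z = nabla (bracket X Y) Z z
    - nabla (bracket (J X) (J Y)) Z z
    - Jst (nabla (bracket (J X) Y) Z z + nabla (bracket X (J Y)) Z z).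
  have E1 : nabla B Z z =
      nabla (bracket X Y) Z z - nabla (bracket (J X) (J Y)) Z z.
    apply: (etrans (nDl (vbr _ _ vX vY) (vf_opp (vbr _ _ vJX vJY)) vZ Pz)).
    by congr (_ + _); exact: (nNl (vbr _ _ vJX vJY) vZ Pz).
  have E2 : nabla (J B) Z z =
      nabla (bracket (J X) Y) Z z + nabla (bracket X (J Y)) Z z.
    apply: (etrans (n_extl (vJ vB) (vf_add (vbr _ _ vJX vY) (vbr _ _ vX vJY))
      vZ Pz (fun x Px => bracket_J vX vY Px))).
    exact: (nDl (vbr _ _ vJX vY) (vbr _ _ vX vJY) vZ Pz).
  exact: (congr2 (fun p r => p - Jst r) E1 E2).
have -> : curvature nabla X Y Z z - Jst (curvature nabla (J X) Y Z z)
    - Jst (curvature nabla X (J Y) Z z) - curvature nabla (J X) (J Y) Z z =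
    nabla10 X (nabla10 Y Z) z - nabla10 Y (nabla10 X Z) z - nabla10 B Z z.
  rewrite NB (nabla10_nabla10 vX vY vZ Pz) (nabla10_nabla10 vY vX vZ Pz).
  rewrite /curvature.
  have alg (a1 a2 a3 a4 b1 b2 b3 b4 c1 c2 c3 c4 : V) :
    a1 - b1 - c1 - Jst (a2 - b2 - c2) - Jst (a3 - b3 - c3) - (a4 - b4 - c4)
    = a1 - Jst a2 - Jst a3 - a4 - (b1 - Jst b3 - Jst b2 - b4)
      - (c1 - c4 - Jst (c2 + c3)).
    rewrite !(JD, JN).
    move: (Jst a2) (Jst a3) (Jst b2) (Jst b3) (Jst c2) (Jst c3) => *.
    by apply: co_inj => i; rewrite !coE; ring.
  exact: alg.
rewrite (nabla10E vB vZ Pz) (nabla10_nabla10E vX vY vZ Pz).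
rewrite (nabla10_nabla10E vY vX vZ Pz).
have CX := vf_C vX; have CY := vf_C vY; have CZ := vf_C vZ.
have CJX := vf_C vJX; have CJY := vf_C vJY.
have S1 := D_bracket oP Pz CX CY CZ.
have S2 := D_bracket oP Pz CJX CY CZ.
have S3 := D_bracket oP Pz CX CJY CZ.
have S4 := D_bracket oP Pz CJX CJY CZ.
have dZ := vf_diff vZ Pz.
have SB : D10 B Z z = 'D_(bracket X Y z) Z z - 'D_(bracket (J X) (J Y) z) Z z
    - Jst ('D_(bracket (J X) Y z) Z z) - Jst ('D_(bracket X (J Y) z) Z z).
  apply: (etrans (congr2 (fun p r => p - Jst r)
    (D_dirD (bracket X Y z) (- bracket (J X) (J Y) z) dZ)
    (etrans (congr1 (fun v => 'D_v Z z) (bracket_J vX vY Pz))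
      (D_dirD (bracket (J X) Y z) (bracket X (J Y) z) dZ)))).
  apply: (etrans (congr1 (fun r => 'D_(bracket X Y z) Z z + r - Jst _)
    (D_dirN (bracket (J X) (J Y) z) dZ))).
  by rewrite JD opprD addrA.
have BE : B z = D10 X Y z - D10 Y X z.
  apply: (etrans (congr2
    (fun p r => 'D_(X z) Y z - 'D_(Y z) X z - (p - r))
    (D_J (Jst (X z)) vY Pz) (D_J (Jst (Y z)) vX Pz))).
  have alg (a1 a2 a3 a4 : V) : a1 - a2 - (a3 - a4) = a1 - a3 - (a2 - a4).
    by apply: co_inj => i; rewrite !coE; ring.
  exact: alg.
have GB : Gam z k (B z) (Z z) =
    Gam z k (D10 X Y z) (Z z) - Gam z k (D10 Y X z) (Z z).
  apply: (etrans (congr1 (fun v => Gam z k v (Z z)) BE)).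
  exact: etrans (Gam_Dl _ _ _ _ _) (congr1 _ (Gam_Nl _ _ _ _)).
have GF := Gam_flat k Pz (X z) (Y z) (Z z).
have alg (a1 a2 a3 a4 b1 b2 b3 b4 g1 g2 g3 g4 f1 f2 d1 d2 d3 d4 e h : V) :
    e = d1 - d4 - Jst d3 - Jst d2 -> h = g1 - g4 -> a1 - b1 = d1 ->
    a3 - b2 = d3 -> a2 - b3 = d2 -> a4 - b4 = d4 -> f1 = f2 ->
    a1 - Jst a2 - Jst a3 - a4 + (g1 + g2 + g3) + f1
    - (b1 - Jst b2 - Jst b3 - b4 + (g4 + g3 + g2) + f2) - (e + h) = 0.
  move=> -> -> <- <- <- <- ->; rewrite !(JD, JN).
  move: (Jst a2) (Jst a3) (Jst b2) (Jst b3) => *.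
  by apply: co_inj => i; rewrite !coE; ring.
exact: (alg _ _ _ _ _ _ _ _ _ _ _ _ _ _ _ _ _ _ _ _ SB GB S1 S2 S3 S4 GF).
Qed.

End Bismut.

(** * The curvature tensor of a connection *)

Section CurvatureTensor.
Variables (R : realType) (n : nat) (a : 'rV[R[i]]_n) (rho : R).
Local Notation V := (Cn R n).
Local Notation vf := (is_vfield a).
Local Notation fn := (is_function a).
Local Notation P := (@punctured R n).
Implicit Types (X Y Z W : V -> V) (z v w : V) (f : V -> R).

Hypothesis a_rho :
  forall j, complex.Re (a 0 j) ^+ 2 + complex.Im (a 0 j) ^+ 2 = rho.
Hypothesis rho0 : rho != 0.

Variables (alpha beta : R).
Local Notation g := (hopf_metric alpha beta).
Local Notation J X := (fun x => Jst (X x)).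
Let vJ X : vf X -> vf (J X) := @vf_J R n a X.
Let oP : open P := @open_punctured R n.
Let vD X Y : vf X -> vf Y -> vf (fun z => 'D_(X z) Y z).
Proof. by move=> vX vY; exact: (vf_D a_rho rho0 vX vY). Qed.
Let fD X f : vf X -> fn f -> fn (fun z => 'D_(X z) f z).
Proof. by move=> vX ff; exact: (fn_D a_rho rho0 vX ff). Qed.
Let vbr X Y : vf X -> vf Y -> vf (bracket X Y).
Proof. by move=> vX vY; exact: (vf_bracket a_rho rho0 vX vY). Qed.

Variable nabla : (V -> V) -> (V -> V) -> (V -> V).
Hypothesis nabla_conn : is_connection a nabla.
Let vn X Y : vf X -> vf Y -> vf (nabla X Y) := n_vf nabla_conn (X:=X) (Y:=Y).
Local Notation curv := (curvature nabla).

Lemma vf_curvature X Y Z : vf X -> vf Y -> vf Z -> vf (curv X Y Z).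
Proof.
move=> vX vY vZ; apply: vf_sub; first by apply: vf_sub; do 2?apply: vn.
by apply: vn => //; exact: vbr.
Qed.

Lemma bracket_ext X X' Y Y' z : P z ->
  (forall x, P x -> X x = X' x) -> (forall x, P x -> Y x = Y' x) ->
  bracket X Y z = bracket X' Y' z.
Proof.
move=> Pz XX YY; apply: (congr2 (fun p r => p - r)).
  exact: (etrans (congr1 (fun v => 'D_v Y z) (XX z Pz)) (D_open _ oP YY Pz)).
exact: (etrans (congr1 (fun v => 'D_v X z) (YY z Pz)) (D_open _ oP XX Pz)).
Qed.

Lemma curvature_ext X X' Y Y' Z Z' z :
  vf X -> vf X' -> vf Y -> vf Y' -> vf Z -> vf Z' -> P z ->
  (forall x, P x -> X x = X' x) -> (forall x, P x -> Y x = Y' x) ->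
  (forall x, P x -> Z x = Z' x) -> curv X Y Z z = curv X' Y' Z' z.
Proof.
move=> vX vX' vY vY' vZ vZ' Pz XX YY ZZ.
have E U U' F F' x : vf U -> vf U' -> vf F -> vf F' -> P x ->
    (forall x, P x -> U x = U' x) -> (forall x, P x -> F x = F' x) ->
    nabla U F x = nabla U' F' x.
  by move=> vU vU' vF vF' Px UU FF; exact: (conn_ext nabla_conn).
have E1 := E _ _ _ _ _ vX vX' (vn vY vZ) (vn vY' vZ') Pz XX
  (fun x Px => E _ _ _ _ _ vY vY' vZ vZ' Px YY ZZ).
have E2 := E _ _ _ _ _ vY vY' (vn vX vZ) (vn vX' vZ') Pz YY
  (fun x Px => E _ _ _ _ _ vX vX' vZ vZ' Px XX ZZ).
have E3 := E _ _ _ _ _ (vbr vX vY) (vbr vX' vY') vZ vZ' Pz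
  (fun x Px => bracket_ext Px XX YY) ZZ.
exact: (congr2 (fun p r => p - r) (congr2 (fun p r => p - r) E1 E2) E3).
Qed.

Lemma curvature_skew X Y Z z : vf X -> vf Y -> vf Z -> P z ->
  curv Y X Z z = - curv X Y Z z.
Proof.
move=> vX vY vZ Pz.
have E : nabla (bracket Y X) Z z = - nabla (bracket X Y) Z z.
  apply: (etrans _ (nNl nabla_conn (vbr vX vY) vZ Pz)).
  by congr (nabla _ _ _); apply/funext => x; rewrite /bracket opprB.
apply: (etrans (congr1
  (fun r => nabla Y (nabla X Z) z - nabla X (nabla Y Z) z - r) E)).
have alg (p r s : V) : p - r - - s = - (r - p - s).
  by apply: co_inj => i; rewrite !coE; ring.
exact: alg.
Qed.

Lemma bracket_linl f X X' Y z : fn f -> vf X -> vf X' -> vf Y -> P z ->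
  bracket (fun x => f x *: X x + X' x) Y z =
  f z *: bracket X Y z + (bracket X' Y z + - 'D_(Y z) f z *: X z).
Proof.
move=> ff vX vX' vY Pz.
have dY := vf_diff vY Pz; have df := fn_diff ff Pz.
have dX := vf_diff vX Pz; have dX' := vf_diff vX' Pz.
have E1 := D_linear (f z) (X z) (X' z) dY.
have E2 := D_add (Y z) (vf_diff (vf_scale ff vX) Pz) dX'.
have E3 := D_scale (Y z) df dX.
apply: (etrans (congr2 (fun p r => p - r) E1
  (etrans E2 (congr1 (fun r => r + _) E3)))).
have alg (c d : R) (p r s t u : V) : c *: p + r - (c *: s + d *: t + u) =
    c *: (p - s) + (r - u + - d *: t).
  by apply: co_inj => i; rewrite !coE; ring.
exact: alg.
Qed.

(** The derivative of f produced by the Leibniz rule in nabla_Y nabla_(fX) is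
    cancelled by the one in the bracket. *)
Lemma curvature_lin1 f X X' Y Z z :
  fn f -> vf X -> vf X' -> vf Y -> vf Z -> P z ->
  curv (fun x => f x *: X x + X' x) Y Z z =
  f z *: curv X Y Z z + curv X' Y Z z.
Proof.
move=> ff vX vX' vY vZ Pz.
have vfX : vf (fun x => f x *: X x + X' x) by apply: vf_add => //; exact: vf_scale.
have E1 := conn_linear nabla_conn ff vX vX' (vn vY vZ) Pz.
have E2 : nabla Y (nabla (fun x => f x *: X x + X' x) Z) z =
    'D_(Y z) f z *: nabla X Z z + f z *: nabla Y (nabla X Z) z
    + nabla Y (nabla X' Z) z.
  have vfn := vf_scale ff (vn vX vZ).
  apply: (etrans (n_extr nabla_conn vY (vn vfX vZ) (vf_add vfn (vn vX' vZ)) Pz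
    (conn_linear nabla_conn ff vX vX' vZ))).
  apply: (etrans (nDr nabla_conn vY vfn (vn vX' vZ) Pz)).
  by congr (_ + _); exact: (nZr nabla_conn ff vY (vn vX vZ) Pz).
have fdf : fn (fun x => - 'D_(Y x) f x).
  have := fn_mul (fn_cst a (-1)) (fD vY ff).
  by congr (is_function _ _); apply/funext => x; rewrite mulN1r.
have E3 : nabla (bracket (fun x => f x *: X x + X' x) Y) Z z =
    f z *: nabla (bracket X Y) Z z +
    (nabla (bracket X' Y) Z z + - 'D_(Y z) f z *: nabla X Z z).
  have v1 := vbr vX vY; have v2 := vbr vX' vY; have v3 := vf_scale fdf vX.
  apply: (etrans (n_extl nabla_conn (vbr vfX vY)
    (vf_add (vf_scale ff v1) (vf_add v2 v3)) vZ Pz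
    (fun x Px => bracket_linl ff vX vX' vY Px))).
  apply: (etrans (conn_linear nabla_conn ff v1 (vf_add v2 v3) vZ Pz)).
  congr (_ + _); apply: (etrans (nDl nabla_conn v2 v3 vZ Pz)).
  by congr (_ + _); exact: (nZl nabla_conn fdf vX vZ Pz).
apply: (etrans (congr2 (fun p r => p - r) (congr2 (fun p r => p - r) E1 E2) E3)).
have alg (c d : R) (p p' r s s' t t' : V) :
    c *: p + p' - (d *: r + c *: s + s') - (c *: t + (t' + - d *: r)) =
    c *: (p - s - t) + (p' - s' - t').
  by apply: co_inj => i; rewrite !coE; ring.
exact: alg.
Qed.

(** The second derivatives of f contribute (X(Yf) - Y(Xf) - [X, Y] f) Z, which
    vanishes by [D_bracket_real]; its first derivatives cancel in pairs. *)
Lemma curvature_lin3 f X Y Z Z' z :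
  fn f -> vf X -> vf Y -> vf Z -> vf Z' -> P z ->
  curv X Y (fun x => f x *: Z x + Z' x) z =
  f z *: curv X Y Z z + curv X Y Z' z.
Proof.
move=> ff vX vY vZ vZ' Pz.
have vfZ := vf_scale ff vZ.
have E1 U x : vf U -> P x -> nabla U (fun x => f x *: Z x + Z' x) x =
    'D_(U x) f x *: Z x + f x *: nabla U Z x + nabla U Z' x.
  move=> vU Px; apply: (etrans (nDr nabla_conn vU vfZ vZ' Px)).
  by congr (_ + _); exact: (nZr nabla_conn ff vU vZ Px).
have E2 U T : vf U -> vf T -> nabla U (nabla T (fun x => f x *: Z x + Z' x)) z =
    'D_(U z) (fun x => 'D_(T x) f x) z *: Z z + 'D_(T z) f z *: nabla U Z z
    + ('D_(U z) f z *: nabla T Z z + f z *: nabla U (nabla T Z) z)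
    + nabla U (nabla T Z') z.
  move=> vU vT.
  have v1 := vf_scale (fD vT ff) vZ; have v2 := vf_scale ff (vn vT vZ).
  have v3 := vn vT vZ'.
  apply: (etrans (n_extr nabla_conn vU (vn vT (vf_add vfZ vZ'))
    (vf_add (vf_add v1 v2) v3) Pz (fun x Px => E1 T x vT Px))).
  apply: (etrans (nDr nabla_conn vU (vf_add v1 v2) v3 Pz)); congr (_ + _).
  apply: (etrans (nDr nabla_conn vU v1 v2 Pz)); congr (_ + _).
    exact: (nZr nabla_conn (fD vT ff) vU vZ Pz).
  exact: (nZr nabla_conn ff vU (vn vT vZ) Pz).
have S := D_bracket_real oP Pz (vf_C vX) (vf_C vY) (fn_C ff).
apply: (etrans (congr2 (fun p r => p - r)
  (congr2 (fun p r => p - r) (E2 X Y vX vY) (E2 Y X vY vX))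
  (E1 (bracket X Y) z (vbr vX vY) Pz))).
have alg (p r s c dx dy : R) (u ux uy uxy uyx ub wxy wyx wb : V) : p - r = s ->
    (p *: u + dy *: ux + (dx *: uy + c *: uxy) + wxy)
    - (r *: u + dx *: uy + (dy *: ux + c *: uyx) + wyx)
    - (s *: u + c *: ub + wb) =
    c *: (uxy - uyx - ub) + (wxy - wyx - wb).
  by move=> <-; apply: co_inj => i; rewrite !coE; ring.
exact: (alg _ _ _ _ _ _ _ _ _ _ _ _ _ _ _ S).
Qed.

Lemma is_tensor4_Omega : is_tensor4 a (Omega g nabla).
Proof.
split=> [X Y Z W vX vY vZ vW|f X' X Y Z W ff vX' vX vY vZ vW z Pz].
  exact: (fn_metric a_rho rho0 alpha beta (vf_curvature vX vY vZ) vW).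
have L1 := curvature_lin1 ff vX vX' vY vZ Pz.
have L2 : curv X (fun x => f x *: Y x + X' x) Z z =
    f z *: curv X Y Z z + curv X X' Z z.
  have vfY : vf (fun x => f x *: Y x + X' x) by apply: vf_add => //; exact: vf_scale.
  apply: (etrans (curvature_skew vfY vX vZ Pz)).
  apply: (etrans (congr1 -%R (curvature_lin1 ff vY vX' vX vZ Pz))).
  rewrite opprD -scalerN; congr (_ *: _ + _); apply/esym.
    exact: curvature_skew vY vX vZ Pz.
  exact: curvature_skew vX' vX vZ Pz.
have L3 := curvature_lin3 ff vX vY vZ vX' Pz.
split; rewrite /Omega.
- by rewrite L1 metricDl metricZl.
- by rewrite L2 metricDl metricZl.
- by rewrite L3 metricDl metricZl.
- by rewrite metricDr metricZr.
Qed.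

Hypothesis nabla_g : metric_parallel a g nabla.

(** The second derivatives of the function g(Z, W) commute up to the bracket. *)
Lemma curvature_metric X Y Z W z : vf X -> vf Y -> vf Z -> vf W -> P z ->
  g z (curv X Y Z z) (W z) + g z (Z z) (curv X Y W z) = 0.
Proof.
move=> vX vY vZ vW Pz.
have fg U T : vf U -> vf T -> fn (fun x => g x (U x) (T x)).
  by move=> vU vT; exact: (fn_metric a_rho rho0 alpha beta vU vT).
have S := D_bracket_real oP Pz (vf_C vX) (vf_C vY) (fn_C (fg Z W vZ vW)).
have E U T : vf U -> vf T ->
    'D_(U z) (fun x => 'D_(T x) (fun y => g y (Z y) (W y)) x) z =
    (g z (nabla U (nabla T Z) z) (W z) + g z (nabla T Z z) (nabla U W z))
    + (g z (nabla U Z z) (nabla T W z) + g z (Z z) (nabla U (nabla T W) z)).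
  move=> vU vT; have [v1 v2] := (vn vT vZ, vn vT vW).
  apply: (etrans (D_open _ oP (fun x Px => nabla_g vT vZ vW Px) Pz)).
  apply: (etrans (D_add _ (fn_diff (fg _ _ v1 vW) Pz)
                          (fn_diff (fg _ _ vZ v2) Pz))).
  exact: (congr2 (fun p r => p + r) (nabla_g vU v1 vW Pz) (nabla_g vU vZ v2 Pz)).
have S' := etrans (esym (congr2 (fun p r => p - r) (E X Y vX vY) (E Y X vY vX)))
  (etrans S (nabla_g (vbr vX vY) vZ vW Pz)).
move: S' {S E fg}; rewrite /curvature.
move: (nabla X (nabla Y Z) z) (nabla Y (nabla X Z) z) (nabla X (nabla Y W) z)
  (nabla Y (nabla X W) z) (nabla (bracket X Y) Z z) (nabla (bracket X Y) W z)
  (nabla X Z z) (nabla Y Z z) (nabla X W z) (nabla Y W z) (Z z) (W z).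
move=> c1 c2 c3 c4 c5 c6 c7 c8 c9 c10 c11 c12; rewrite !gE; lra.
Qed.

Hypothesis nabla_J : J_parallel a nabla.

Lemma curvature_J X Y Z z : vf X -> vf Y -> vf Z -> P z ->
  curv X Y (J Z) z = Jst (curv X Y Z z).
Proof.
move=> vX vY vZ Pz.
have E U T : vf U -> vf T -> nabla U (nabla T (J Z)) z =
    Jst (nabla U (nabla T Z) z).
  move=> vU vT.
  apply: (etrans (n_extr nabla_conn vU (vn vT (vJ vZ)) (vJ (vn vT vZ)) Pz
    (fun x Px => nabla_J vT vZ Px))).
  exact: (nabla_J vU (vn vT vZ) Pz).
apply: (etrans (congr2 (fun p r => p - r)
  (congr2 (fun p r => p - r) (E X Y vX vY) (E Y X vY vX))
  (nabla_J (vbr vX vY) vZ Pz))).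
have alg (p r s : V) : Jst p - Jst r - Jst s = Jst (p - r - s).
  by rewrite !(JD, JN).
exact: alg.
Qed.

End CurvatureTensor.

(** * Decomposition of the curvature into types *)

Section TypeDecomposition.
Variables (R : realType) (n : nat) (a : 'rV[R[i]]_n) (rho : R).
Local Notation V := (Cn R n).
Local Notation vf := (is_vfield a).
Local Notation P := (@punctured R n).
Local Notation J X := (fun x => Jst (X x)).
Implicit Types (X Y Z W : V -> V) (z : V).

(** Fields of type (1,0), for [e = -1], and of type (0,1), for [e = 1]. *)
Definition typed (e : R) (X : (V -> V) * (V -> V)) : Prop :=
  forall z, P z -> X.2 z = e *: Jst (X.1 z).

Lemma same_typeP (X Y : (V -> V) * (V -> V)) :
  (type10 X /\ type10 Y) \/ (type01 X /\ type01 Y) ->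
  exists e : R, [/\ e * e = 1, typed e X & typed e Y].
Proof.
case=> -[tX tY]; [exists (-1) | exists 1]; split; rewrite ?mulr1 ?mulrNN ?mulr1//.
- by move=> z Pz; have [-> _] := tX z Pz; rewrite scaleN1r opprK.
- by move=> z Pz; have [-> _] := tY z Pz; rewrite scaleN1r opprK.
- by move=> z Pz; have [-> _] := tX z Pz; rewrite scale1r.
- by move=> z Pz; have [-> _] := tY z Pz; rewrite scale1r.
Qed.

Section ComplexExtension.
Variable T : (V -> V) -> (V -> V) -> (V -> V) -> (V -> V) -> V -> R.
Variables (X Y Z W : (V -> V) * (V -> V)) (z : V).

(** In both lemmas the sixteen terms are a multiple of 1 + i^2 plus pairs of
   opposite terms. *)
Lemma cext_eq0l :
  (forall r s, T X.2 Y.2 (part Z r) (part W s) z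
               = T X.1 Y.1 (part Z r) (part W s) z) ->
  (forall r s, T X.2 Y.1 (part Z r) (part W s) z
               = - T X.1 Y.2 (part Z r) (part W s) z) ->
  cext T X Y Z W z = 0.
Proof.
move=> H1 H2; rewrite /cext !big_bool [part X true]/= [part X false]/=
  [part Y true]/= [part Y false]/= !H1 !H2 !rmorphN/=.
rewrite !exprD !expr0 !expr1.
move: (T _ _ _ _ _)%:C%C (T _ _ _ _ _)%:C%C (T _ _ _ _ _)%:C%C
  (T _ _ _ _ _)%:C%C (T _ _ _ _ _)%:C%C (T _ _ _ _ _)%:C%C
  (T _ _ _ _ _)%:C%C (T _ _ _ _ _)%:C%C => t1 t2 t3 t4 t5 t6 t7 t8.
have := sqr_i R; rewrite expr2; move: ('i%C : R[i]) => I I2.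
transitivity ((1 + I * I) * (t5 + I * t6 + I * t7 + I * I * t8)); first by ring.
by rewrite I2 subrr mul0r.
Qed.

Lemma cext_eq0r :
  (forall p r, T (part X p) (part Y r) Z.2 W.2 z
               = T (part X p) (part Y r) Z.1 W.1 z) ->
  (forall p r, T (part X p) (part Y r) Z.2 W.1 z
               = - T (part X p) (part Y r) Z.1 W.2 z) ->
  cext T X Y Z W z = 0.
Proof.
move=> H1 H2; rewrite /cext !big_bool [part Z true]/= [part Z false]/=
  [part W true]/= [part W false]/= !H1 !H2 !rmorphN/=.
rewrite !exprD !expr0 !expr1.
move: (T _ _ _ _ _)%:C%C (T _ _ _ _ _)%:C%C (T _ _ _ _ _)%:C%C
  (T _ _ _ _ _)%:C%C (T _ _ _ _ _)%:C%C (T _ _ _ _ _)%:C%C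
  (T _ _ _ _ _)%:C%C (T _ _ _ _ _)%:C%C => t1 t2 t3 t4 t5 t6 t7 t8.
have := sqr_i R; rewrite expr2; move: ('i%C : R[i]) => I I2.
transitivity ((1 + I * I) * (I * I * t8 + I * t6 + I * t4 + t2)); first by ring.
by rewrite I2 subrr mul0r.
Qed.

End ComplexExtension.

Hypothesis a_rho :
  forall j, complex.Re (a 0 j) ^+ 2 + complex.Im (a 0 j) ^+ 2 = rho.
Hypothesis rho0 : rho != 0.
Variables (alpha beta : R).
Hypotheses (alpha0 : 0 < alpha) (betaN : - alpha < beta).
Local Notation g := (hopf_metric alpha beta).
Variable nabla : (V -> V) -> (V -> V) -> (V -> V).
Hypothesis bismut : is_bismut a g nabla.
Local Notation O := (Omega g nabla).
Local Notation curv := (curvature nabla).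
Let nabla_conn : is_connection a nabla. Proof. by case: bismut. Qed.
Let nabla_g : metric_parallel a g nabla. Proof. by case: bismut. Qed.
Let nabla_J : J_parallel a nabla. Proof. by case: bismut. Qed.
Let nabla_skew : skew_torsion a g nabla. Proof. by case: bismut. Qed.
Let vJ X : vf X -> vf (J X) := @vf_J R n a X.

Lemma Omega_skewl X Y Z W z : vf X -> vf Y -> vf Z -> P z ->
  O Y X Z W z = - O X Y Z W z.
Proof.
move=> vX vY vZ Pz; rewrite /Omega.
by rewrite (curvature_skew a_rho rho0 nabla_conn vX vY vZ Pz) metricNl.
Qed.

Lemma Omega_skewr X Y Z W z : vf X -> vf Y -> vf Z -> vf W -> P z ->
  O X Y W Z z = - O X Y Z W z.
Proof.
move=> vX vY vZ vW Pz; rewrite /Omega [LHS]metricC.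
by apply/eqP; rewrite -addr_eq0 addrC; apply/eqP;
  exact: (curvature_metric a_rho rho0 nabla_conn nabla_g vX vY vZ vW Pz).
Qed.

Lemma Omega_Jr X Y Z W z : vf X -> vf Y -> vf Z -> P z ->
  O X Y (J Z) W z = - O X Y Z (J W) z.
Proof.
move=> vX vY vZ Pz; rewrite /Omega.
by rewrite (curvature_J a_rho rho0 nabla_conn nabla_J vX vY vZ Pz) metricJl.
Qed.

Let Omega10 X Y Z W z : vf X -> vf Y -> vf Z -> P z ->
  O X Y Z W z - O (J X) (J Y) Z W z
  + (O (J X) Y Z (J W) z + O X (J Y) Z (J W) z) = 0.
Proof.
move=> vX vY vZ Pz.
have alphaN0 : alpha != 0 by rewrite gt_eqF.
have betaE : beta = beta / alpha * alpha by rewrite divfK.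
have := curvature10_eq0 a_rho rho0 alpha0 betaN betaE nabla_conn nabla_g nabla_J
  nabla_skew vX vY vZ Pz.
move=> /(congr1 (fun v => g z v (W z))); rewrite /Omega.
move: (curv X Y Z z) (curv (J X) Y Z z) (curv X (J Y) Z z)
  (curv (J X) (J Y) Z z) (W z) => c1 c2 c3 c4 w.
rewrite -[X in _ = g z X w](scale0r (0 : V)) !gE !metricJl mul0r; lra.
Qed.

(** In [Omega10] the first bracket is skew in Z and W, while the second one is
    symmetric because Omega is J-invariant in its last two arguments; so both
    vanish. *)
Lemma Omega_J_pair X Y Z W z : vf X -> vf Y -> vf Z -> vf W -> P z ->
  O (J X) (J Y) Z W z = O X Y Z W z /\
  O (J X) Y Z (J W) z + O X (J Y) Z (J W) z = 0.
Proof.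
move=> vX vY vZ vW Pz.
have alg (p q r s p' q' r' s' t u : R) : p - q + (r + s) = 0 ->
    p' - q' + (r' + s') = 0 -> p' = - p -> q' = - q -> r' = - t -> s' = - u ->
    t = - r -> u = - s -> q = p /\ r + s = 0.
  by move=> *; split; lra.
have [vJX vJY] := (vJ vX, vJ vY); have [vJZ vJW] := (vJ vZ, vJ vW).
have H1 := Omega10 W vX vY vZ Pz; have H2 := Omega10 Z vX vY vW Pz.
have s1 := Omega_skewr vX vY vZ vW Pz.
have s2 := Omega_skewr vJX vJY vZ vW Pz.
have s3 := Omega_skewr vJX vY vJZ vW Pz.
have s4 := Omega_skewr vX vJY vJZ vW Pz.
have j3 := Omega_Jr W vJX vY vZ Pz.
have j4 := Omega_Jr W vX vJY vZ Pz.
exact: (alg _ _ _ _ _ _ _ _ _ _ H1 H2 s1 s2 s3 s4 j3 j4).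
Qed.

Lemma Omega_JX X Y Z W z : vf X -> vf Y -> vf Z -> vf W -> P z ->
  O (J X) Y Z W z = - O X (J Y) Z W z.
Proof.
have alg (p r p' r' : R) : p' + r' = 0 -> p' = - p -> r' = - r -> p = - r.
  by move=> *; lra.
move=> vX vY vZ vW Pz.
have [_ H] := Omega_J_pair vX vY vZ (vJ vW) Pz.
have NJJ U T : O U T Z (J (J W)) z = - O U T Z W z.
  exact: etrans (congr1 (g z (curv U T Z z)) (JJ (W z))) (metricNr _ _ _ _ _).
exact: alg H (NJJ _ _) (NJJ _ _).
Qed.

Lemma curvature_scale1 (c : R) X Y Z z : vf X -> vf Y -> vf Z -> P z ->
  curv (fun x => c *: X x) Y Z z = c *: curv X Y Z z.
Proof.
move=> vX vY vZ Pz.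
have v0 : vf (fun=> 0).
  have := vf_sub vX vX.
  by congr (is_vfield _ _); apply/funext => x; rewrite subrr.
have E d U : vf U -> curv (fun x => d *: U x + 0) Y Z z =
    d *: curv U Y Z z + curv (fun=> 0) Y Z z.
  by move=> vU; exact: (curvature_lin1 a_rho rho0 nabla_conn (fn_cst a d) vU v0).
have c0 : curv (fun=> 0) Y Z z = 0.
  have := E 1 (fun=> 0) v0.
  rewrite (_ : (fun x : V => 1 *: 0 + 0) = (fun=> 0 : V)); last first.
    by apply/funext => x; rewrite scaler0 addr0.
  rewrite scale1r => /eqP; rewrite -subr_eq0 opprD addrA subrr sub0r oppr_eq0.
  by move/eqP.
have := E c X vX; rewrite c0 addr0 => <-.
by congr (curv _ _ _ _); apply/funext => x; rewrite addr0.
Qed.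

Let vcZ (c : R) X : vf X -> vf (fun x => c *: X x).
Proof. by move=> vX; exact: vf_scale (fn_cst a c) vX. Qed.

Lemma Omega_typed1 e (X : (V -> V) * (V -> V)) Y Z W z :
  is_cvfield a X -> typed e X -> vf Y -> vf Z ->
  P z -> O X.2 Y Z W z = e * O (J X.1) Y Z W z.
Proof.
move=> [v1 v2] tX vY vZ Pz; have vJ1 := vJ v1.
have E1 := curvature_ext a_rho rho0 nabla_conn v2 (vcZ e vJ1) vY vY vZ vZ Pz tX
  (fun _ _ => erefl) (fun _ _ => erefl).
have E := etrans E1 (curvature_scale1 e vJ1 vY vZ Pz).
exact: etrans (congr1 (fun v => g z v (W z)) E) (metricZl _ _ _ _ _ _).
Qed.

Lemma Omega_typed2 e X (Y : (V -> V) * (V -> V)) Z W z :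
  is_cvfield a Y -> typed e Y -> vf X -> vf Z ->
  P z -> O X Y.2 Z W z = e * O X (J Y.1) Z W z.
Proof.
move=> cY tY vX vZ Pz; have [v1 v2] := cY.
rewrite (Omega_skewl W v2 vX vZ Pz) (Omega_typed1 W cY tY vX vZ Pz).
by rewrite (Omega_skewl W vX (vJ v1) vZ Pz); ring.
Qed.

Lemma Omega_typed4 e X Y Z (W : (V -> V) * (V -> V)) z : typed e W -> P z ->
  O X Y Z W.2 z = e * O X Y Z (J W.1) z.
Proof. by move=> tW Pz; rewrite /Omega (tW z Pz) metricZr. Qed.

Lemma Omega_typed3 e X Y (Z : (V -> V) * (V -> V)) W z :
  is_cvfield a Z -> typed e Z -> vf X -> vf Y ->
  vf W -> P z -> O X Y Z.2 W z = e * O X Y (J Z.1) W z.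
Proof.
move=> [v1 v2] tZ vX vY vW Pz.
rewrite (Omega_skewr vX vY vW v2 Pz) (Omega_typed4 X Y W tZ Pz).
by rewrite (Omega_skewr vX vY (vJ v1) vW Pz); ring.
Qed.

Lemma in_L11_L11_Omega : in_L11_L11 a O.
Proof.
have vpart A r : is_cvfield a A -> vf (part A r) by move=> [v1 v2]; case: r.
split.
- exact: (is_tensor4_Omega a_rho rho0 alpha beta nabla_conn).
- move=> X Y Z W vX vY vZ vW z Pz.
  by split; [exact: Omega_skewl | exact: Omega_skewr].
- move=> X Y Z W cX cY cZ cW /same_typeP[e [ee tX tY]] z Pz.
  have [[vX vX2] [vY vY2]] := (cX, cY).
  apply: cext_eq0l => r s; have [vZ vW] := (vpart Z r cZ, vpart W s cW).
    rewrite (Omega_typed1 _ cX tX vY2 vZ Pz) (Omega_typed2 _ cY tY (vJ vX) vZ Pz).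
    by rewrite mulrA ee mul1r; have [] := Omega_J_pair vX vY vZ vW Pz.
  rewrite (Omega_typed1 _ cX tX vY vZ Pz) (Omega_typed2 _ cY tY vX vZ Pz).
  by rewrite (Omega_JX vX vY vZ vW Pz) mulrN.
- move=> X Y Z W cX cY cZ cW /same_typeP[e [ee tZ tW]] z Pz.
  have [[vZ vZ2] [vW vW2]] := (cZ, cW).
  apply: cext_eq0r => p r; have [vX vY] := (vpart X p cX, vpart Y r cY).
    rewrite (Omega_typed4 _ _ _ tW Pz) (Omega_typed3 cZ tZ vX vY (vJ vW) Pz).
    rewrite (Omega_Jr _ vX vY vZ Pz) mulrA ee mul1r.
    apply: (canLR (@opprK _)).
    exact: etrans (congr1 (g z _) (JJ (W.1 z))) (metricNr _ _ _ _ _).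
  rewrite (Omega_typed4 _ _ _ tW Pz) (Omega_typed3 cZ tZ vX vY vW Pz).
  by rewrite (Omega_Jr _ vX vY vZ Pz) mulrN.
Qed.

End TypeDecomposition.
Theorem proposition2 (R : realType) (n : nat) (a : 'rV[R[i]]_n)
  (ha : a != 0)
  (hmod : forall i j : 'I_n, `|a 0 i| = `|a 0 j|)
  (hne1 : forall i : 'I_n, `|a 0 i| != 1)
  (alpha beta : R) (halpha : 0 < alpha) (hbeta : - alpha < beta)
  (nabla : (Cn R n -> Cn R n) -> (Cn R n -> Cn R n) -> (Cn R n -> Cn R n)) :
  is_bismut a (hopf_metric alpha beta) nabla ->
  in_L11_L11 a (Omega (hopf_metric alpha beta) nabla).
Proof.
move=> bismut.
have [j0 aj0] : exists j0, a 0 j0 != 0.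
  apply/existsP; apply: contraNT ha => /existsPn a0.
  by apply/eqP/rowP => j; rewrite mxE; apply/eqP; move: (a0 j); rewrite negbK.
pose rho := complex.Re (a 0 j0) ^+ 2 + complex.Im (a 0 j0) ^+ 2.
have a_rho j : complex.Re (a 0 j) ^+ 2 + complex.Im (a 0 j) ^+ 2 = rho.
  by apply: complexI; rewrite !add_Re2_Im2 (hmod j j0).
have rho0 : rho != 0.
  rewrite -(inj_eq (@complexI R)) add_Re2_Im2.
  by rewrite expf_eq0/= normr_eq0.
exact: (in_L11_L11_Omega a_rho rho0 halpha hbeta bismut).
Qed.
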